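(* Let $\Phi:\mathbb{M}_n\to\mathbb{M}_l$ and $\Psi:\mathbb{M}_m\to\mathbb{M}_l$ be positive linear maps and let $0\le\alpha\le1$. Then for every $A\in\mathbb{M}_n^+$ and $B\in\mathbb{M}_m^+$, $$\bigl(\|\Phi(I_n)\|_\infty\,\#_\alpha\,\|\Psi(I_m)\|_\infty\bigr)^{r-1}\lambda\bigl(\Phi(A^r)\,\#_\alpha\,\Psi(B^r)\bigr)\prec^{w(\log)}\lambda^r\bigl(\Phi(A)\,\#_\alpha\,\Psi(B)\bigr)$$ for all $r\ge1$. Consequently, if $\|\Phi(I_n)\|_\infty\,\#_\alpha\,\|\Psi(I_m)\|_\infty\le1$, then $$\lambda\bigl(\Phi(A^r)\,\#_\alpha\,\Psi(B^r)\bigr)\prec^{w(\log)}\lambda^r\bigl(\Phi(A)\,\#_\alpha\,\Psi(B)\bigr),\qquad r\ge1.$$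
   Context: $\mathbb{M}_n$ is the algebra of $n\times n$ complex matrices and $\mathbb{M}_n^+$ the set of positive semidefinite matrices in $\mathbb{M}_n$; $\|\cdot\|_\infty$ is the operator norm; $A>0$ means $A$ is positive definite. A linear map $\Phi:\mathbb{M}_n\to\mathbb{M}_l$ is positive if $\Phi(A)\in\mathbb{M}_l^+$ for all $A\in\mathbb{M}_n^+$. Convention: $0^0:=1$. For $0\le\alpha\le1$ the weighted geometric mean is $A\,\#_\alpha\,B:=A^{1/2}(A^{-1/2}BA^{-1/2})^\alpha A^{1/2}$ for $A,B\in\mathbb{M}_l^+$ with $A>0$, extended to all $A,B\in\mathbb{M}_l^+$ by $A\,\#_\alpha\,B:=\lim_{\varepsilon\searrow0}(A+\varepsilon I)\,\#_\alpha\,(B+\varepsilon I)$. For scalars $a,b\ge0$, $a\,\#_\alpha\,b=a^{1-\alpha}b^\alpha$. For $X\in\mathbb{M}_l^+$, $\lambda(X)=(\lambda_1(X),\dots,\lambda_l(X))$ is the vector of eigenvalues of $X$ in decreasing order with multiplicities, and $\lambda^r(X)=(\lambda_1(X)^r,\dots,\lambda_l(X)^r)$. For non-negative decreasing vectors $a=(a_1\ge\dots\ge a_l\ge0)$ and $b=(b_1\ge\dots\ge b_l\ge0)$, the log-supermajorization $a\prec^{w(\log)}b$ means $\prod_{i=l-k+1}^la_i\ge\prod_{i=l-k+1}^lb_i$ for all $1\le k\le l$. *)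

(* Defs.v *)
(* The complex numbers are R[i] for R : realType. *)
From mathcomp Require Export all_boot all_order all_algebra complex.
From mathcomp Require Export all_classical all_reals all_analysis.
Export numFieldNormedType.Exports.

Set Implicit Arguments.
Unset Strict Implicit.
Unset Printing Implicit Defensive.

Import Order.TTheory GRing.Theory Num.Theory.

Local Open Scope classical_set_scope.
Local Open Scope sesquilinear_scope.
Local Open Scope complex_scope.
Local Open Scope ring_scope.

Definition psdmx (R : realType) (n : nat) (A : 'M[R[i]]_n) : Prop :=
  A \is hermsymmx /\ forall v : 'cV[R[i]]_n, 0 <= (v^t* *m A *m v) 0 0.

Definition positive_map (R : realType) (n l : nat)
    (Phi : 'M[R[i]]_n -> 'M[R[i]]_l) : Prop :=
  forall A, psdmx A -> psdmx (Phi A).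

Definition euclnorm (R : realType) (n : nat) (v : 'cV[R[i]]_n) : R :=
  Num.sqrt (\sum_(i < n) Normc.normc (v i 0) ^+ 2).

Definition opnorm (R : realType) (m n : nat) (A : 'M[R[i]]_(m, n)) : R :=
  sup [set euclnorm (A *m v) | v in [set v | euclnorm v <= 1]].

(* Functional calculus t |-> t^r on the spectral decomposition of A, which is
   meaningful when A is positive semidefinite (and positive definite if r < 0).
   powR satisfies 0 `^ 0 = 1. *)
Definition mxpowR (R : realType) (n : nat) (A : 'M[R[i]]_n) (r : R)
    : 'M[R[i]]_n :=
  invmx (spectralmx A)
  *m diag_mx (map_mx (fun z => (complex.Re z `^ r)%:C) (spectral_diag A))
  *m spectralmx A.

Definition geomean_pd (R : realType) (l : nat) (alpha : R) (A B : 'M[R[i]]_l)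
    : 'M[R[i]]_l :=
  let Ah := mxpowR A (1 / 2) in
  let Aih := mxpowR A (- (1 / 2)) in
  Ah *m mxpowR (Aih *m B *m Aih) alpha *m Ah.

(* R[i]^o is R[i] seen as a normed module over itself: this is what carries the
   topology used for the limit. *)
Definition geomean (R : realType) (l : nat) (alpha : R) (A B : 'M[R[i]]_l)
    : 'M[R[i]]_l :=
  lim ((geomean_pd alpha (A + e%:C%:M) (B + e%:C%:M) : 'M[R[i]^o]_l)
         @[e --> (0 : R)^'+]).

Definition sgeomean (R : realType) (alpha a b : R) : R :=
  a `^ (1 - alpha) * b `^ alpha.

(* The roots of the characteristic polynomial, counted with multiplicity, are
   real for Hermitian X; index i : 'I_l stands for lambda_(i+1). *)
Definition lambda (R : realType) (l : nat) (X : 'M[R[i]]_l) : 'rV[R]_l :=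
  \row_(i < l)
    (sort >=%R [seq complex.Re z
               | z <- sval (closed_field_poly_normal (char_poly X))])`_i.

Definition rvpowR (R : realType) (l : nat) (a : 'rV[R]_l) (r : R) : 'rV[R]_l :=
  map_mx (fun t => t `^ r) a.

(* With 0-based indices, the product over l-k+1 <= i <= l becomes the one over
   l-k <= i < l. *)
Definition wlog_supermaj (R : realType) (l : nat) (a b : 'rV[R]_l) : Prop :=
  forall k : nat, (1 <= k <= l)%N ->
    \prod_(i < l | (l - k <= i)%N) b 0 i
      <= \prod_(i < l | (l - k <= i)%N) a 0 i.

(* Main.v *)
(* Let c = ||Phi(I)|| #_alpha ||Psi(I)|| and write A # B for A #_alpha B.

   A positive linear map with Phi(I) <= I satisfies Phi(A) <= Phi(A^r)^(1/r) for
   r >= 1, so after normalization and monotonicity of the mean in both arguments,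
   Phi(A) # Psi(B) is bounded by a multiple of X^(1/r) # Y^(1/r) with
   X = Phi(A^r) and Y = Psi(B^r).  The Ando-Hiai implication
   "S # T >= I implies S^r # T^r >= I", applied to k-th compound matrices, whose
   smallest eigenvalue is the product of the k smallest eigenvalues, gives
   prod lambda_i(S # T)^r <= prod lambda_i(S^r # T^r) over the k smallest
   eigenvalues.  Take S = X^(1/r), T = Y^(1/r).  The singular case follows by
   perturbing X and Y by e I: the regularized means decrease to the mean as e
   decreases to 0.

   Operator monotonicity of t^s, Jensen's inequality and joint monotonicity of
   the mean all come from one statement (pos_jensen), proved by a midpoint
   argument in the exponent. *)
Require Import Defs.
From HB Require Import structures.
From mathcomp Require Import fingroup perm zify ring lra.

Set Implicit Arguments.
Unset Strict Implicit.
Unset Printing Implicit Defensive.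

Import Order.TTheory GRing.Theory Num.Theory.

Local Open Scope classical_set_scope.
Local Open Scope sesquilinear_scope.
Local Open Scope complex_scope.
Local Open Scope ring_scope.

(** * Hermitian forms and the Loewner order *)

(** The factor [c^(r-1)] comes from normalization. For [x >= ||Phi(I)||], Jensen's inequality for
    [x^(-1) Phi] with exponent [1/r] gives [Phi(A) <= x^(1-1/r) Phi(A^r)^(1/r)]. The [r]-th power of
    the right side carries [x^(r-1)], and the mean is homogeneous with weights [1-a] and [a], so the
    factors of [Phi] and [Psi] combine to [(x #_a y)^(r-1)].

    Compounds are compatible with the mean because they are multiplicative: they send unitary
    diagonalizations to unitary diagonalizations, hence powers to powers.

    The obstacle is degeneracy: the images may be singular and the norms zero, whereas the explicit
    mean and the Ando-Hiai step involve inverses. Once the limit defining the mean is identified,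
    singular means enter only through order bounds by regularized means. The eigenvalues of
    [X + h I] are those of [X] shifted by [h], so the last limit concerns a finite product of real
    functions of [h]. *)

(* The definitions below are locked because unification would otherwise compare
   matrices by unfolding them down to spectral decompositions. *)
HB.lock Definition bf (R : realType) n (A : 'M[R[i]]_n) (u v : 'cV[R[i]]_n) : R :=
  complex.Re ((u^t* *m A *m v) 0 0).

Definition qf (R : realType) n (A : 'M[R[i]]_n) (v : 'cV[R[i]]_n) : R := bf A v v.

HB.lock Definition lemx (R : realType) n (A B : 'M[R[i]]_n) : Prop := psdmx (B - A).

Section Adjoint.
Context {R : realType}.
Local Notation C := R[i].

Lemma conjCE (x : C) : Num.conj x = conjc x.
Proof. by []. Qed.

Lemma conj_real (x : R) : Num.conj (x%:C) = x%:C :> C.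
Proof. by rewrite conjCE conjc_real. Qed.

Lemma adjM m n p (A : 'M[C]_(m, n)) (B : 'M[C]_(n, p)) :
  (A *m B)^t* = B^t* *m A^t*.
Proof. by rewrite trmx_mul map_mxM. Qed.

Lemma adjD m n (A B : 'M[C]_(m, n)) : (A + B)^t* = A^t* + B^t*.
Proof. by rewrite linearD map_mxD. Qed.

Lemma adjB m n (A B : 'M[C]_(m, n)) : (A - B)^t* = A^t* - B^t*.
Proof. by rewrite linearB map_mxB. Qed.

Lemma adjZ m n (a : R) (A : 'M[C]_(m, n)) : (a%:C *: A)^t* = a%:C *: A^t*.
Proof. by rewrite linearZ map_mxZ /= conj_real. Qed.

Lemma adj_scalar n (a : R) : (a%:C%:M)^t* = a%:C%:M :> 'M[C]_n.
Proof. by rewrite tr_scalar_mx map_scalar_mx /= conj_real. Qed.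

Lemma adj1 n : (1%:M)^t* = 1%:M :> 'M[C]_n.
Proof. by rewrite trmx1 map_mx1. Qed.

Lemma hermP n (A : 'M[C]_n) : A \is hermsymmx <-> A^t* = A.
Proof.
split=> [/is_hermitianmxP|h]; first by rewrite expr0 scale1r => <-.
by apply/is_hermitianmxP; rewrite expr0 scale1r h.
Qed.

Lemma qfE n (A : 'M[C]_n) u : qf A u = bf A u u.
Proof. by []. Qed.

Lemma herm_form_real n (A : 'M[C]_n) v : A^t* = A ->
  (v^t* *m A *m v) 0 0 = (qf A v)%:C.
Proof.
move=> hA; rewrite /qf bf.unlock RRe_real //; apply/CrealP.
have {2}<- : (v^t* *m A *m v)^t* = v^t* *m A *m v.
  by rewrite !adjM trmxCK hA mulmxA.
by rewrite !mxE.
Qed.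

Lemma psdP n (A : 'M[C]_n) :
  psdmx A <-> A^t* = A /\ forall v, 0 <= qf A v.
Proof.
split=> [[/hermP hA h]|[hA h]].
  by split=> // v; have := h v; rewrite herm_form_real // ler0c.
by split=> [|v]; [exact/hermP | rewrite herm_form_real // ler0c].
Qed.

Lemma qfD n (A B : 'M[C]_n) v : qf (A + B) v = qf A v + qf B v.
Proof.
rewrite /qf bf.unlock mulmxDr mulmxDl mxE.
by case: (_ 0 0) => ? ?; case: (_ 0 0).
Qed.

Lemma qfB n (A B : 'M[C]_n) v : qf (A - B) v = qf A v - qf B v.
Proof.
rewrite /qf bf.unlock mulmxBr mulmxBl; move: (_ *m _) (_ *m _) => X Y; rewrite !mxE.
by case: (X 0 0) => ? ?; case: (Y 0 0).
Qed.

Lemma qfZ n (a : R) (A : 'M[C]_n) v : qf (a%:C *: A) v = a * qf A v.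
Proof.
rewrite /qf bf.unlock -scalemxAr -scalemxAl mxE.
by case: (_ 0 0) => x y /=; rewrite mul0r subr0.
Qed.

Lemma qf_congr m n (A : 'M[C]_m) (S : 'M[C]_(m, n)) v :
  qf (S^t* *m A *m S) v = qf A (S *m v).
Proof. by rewrite /qf bf.unlock adjM !mulmxA. Qed.

Lemma herm_congr m n (A : 'M[C]_m) (S : 'M[C]_(m, n)) :
  A^t* = A -> (S^t* *m A *m S)^t* = S^t* *m A *m S.
Proof. by move=> hA; rewrite !adjM trmxCK hA mulmxA. Qed.

Lemma psd_herm n (A : 'M[C]_n) : psdmx A -> A^t* = A.
Proof. by case/psdP. Qed.

Lemma psd_congr m n (A : 'M[C]_m) (S : 'M[C]_(m, n)) :
  psdmx A -> psdmx (S^t* *m A *m S).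
Proof.
case/psdP=> hA h; apply/psdP; split=> [|v]; first exact: herm_congr.
by rewrite qf_congr.
Qed.

Lemma psdD n (A B : 'M[C]_n) : psdmx A -> psdmx B -> psdmx (A + B).
Proof.
case/psdP=> hA pA /psdP[hB pB]; apply/psdP; split; first by rewrite adjD hA hB.
by move=> v; rewrite qfD addr_ge0.
Qed.

Lemma psdZ n (a : R) (A : 'M[C]_n) : 0 <= a -> psdmx A -> psdmx (a%:C *: A).
Proof.
move=> a0 /psdP[hA pA]; apply/psdP; split; first by rewrite adjZ hA.
by move=> v; rewrite qfZ mulr_ge0.
Qed.

Lemma qf0 n (v : 'cV[C]_n) : qf 0 v = 0.
Proof. by rewrite /qf bf.unlock mulmx0 mul0mx mxE. Qed.

Lemma qf_vec0 n (A : 'M[C]_n) : qf A 0 = 0.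
Proof. by rewrite /qf bf.unlock mulmx0 mxE. Qed.

Lemma psd0 n : psdmx (0 : 'M[C]_n).
Proof.
apply/psdP; split=> [|v]; last by rewrite qf0.
by apply/matrixP=> i j; rewrite !mxE conjC0.
Qed.

Lemma qf1E n (v : 'cV[C]_n) : qf 1%:M v = \sum_i Normc.normc (v i 0) ^+ 2.
Proof.
apply: complexI; rewrite -herm_form_real ?adj1 // mulmx1 mxE rmorph_sum.
apply: eq_bigr => i _; rewrite !mxE rmorphXn /=.
by rewrite mulrC -normCK.
Qed.

Lemma qf1_ge0 n (v : 'cV[C]_n) : 0 <= qf 1%:M v.
Proof. by rewrite qf1E sumr_ge0 // => i _; rewrite sqr_ge0. Qed.

Lemma qf1_gt0 n (v : 'cV[C]_n) : v != 0 -> 0 < qf 1%:M v.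
Proof.
move=> v0; rewrite lt_def qf1_ge0 andbT; apply: contra v0.
rewrite qf1E psumr_eq0; last by move=> i _; rewrite sqr_ge0.
move=> /allP h; apply/eqP/matrixP=> i j; rewrite ord1 mxE.
have := h i (mem_index_enum _); rewrite /= sqrf_eq0 => /eqP.
exact: Normc.eq0_normc.
Qed.

Lemma psd1 n : psdmx (1%:M : 'M[C]_n).
Proof. by apply/psdP; split; [exact: adj1 | exact: qf1_ge0]. Qed.

Lemma scalar_mxZ1 n (a : R) : a%:C%:M = a%:C *: 1%:M :> 'M[C]_n.
Proof. by rewrite scale_scalar_mx mulr1. Qed.

Lemma qf_scalar n (a : R) (v : 'cV[C]_n) : qf a%:C%:M v = a * qf 1%:M v.
Proof. by rewrite scalar_mxZ1 qfZ. Qed.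

Lemma lemxE n (A B : 'M[C]_n) : lemx A B <-> psdmx (B - A).
Proof. by rewrite lemx.unlock. Qed.

Lemma lemxx n (A : 'M[C]_n) : lemx A A.
Proof. by rewrite lemx.unlock subrr; exact: psd0. Qed.

Lemma lemx_trans n (B A D : 'M[C]_n) : lemx A B -> lemx B D -> lemx A D.
Proof. by rewrite lemx.unlock => h1 h2; rewrite -(subrKA B); exact: (psdD h2 h1). Qed.

Lemma lemx0 n (A : 'M[C]_n) : lemx 0 A <-> psdmx A.
Proof. by rewrite lemx.unlock subr0. Qed.

Lemma lemxD n (A B D E : 'M[C]_n) : lemx A B -> lemx D E -> lemx (A + D) (B + E).
Proof. by rewrite lemx.unlock => h1 h2; rewrite opprD addrACA; exact: (psdD h1 h2). Qed.

Lemma lemxZ n (a : R) (A B : 'M[C]_n) : 0 <= a -> lemx A B ->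
  lemx (a%:C *: A) (a%:C *: B).
Proof. by rewrite lemx.unlock => a0 h; rewrite -scalerBr; exact: psdZ. Qed.

Lemma lemxZr n (a b : R) (A : 'M[C]_n) : a <= b -> psdmx A ->
  lemx (a%:C *: A) (b%:C *: A).
Proof.
by move=> ab h; rewrite lemx.unlock -scalerBl -rmorphB; apply: psdZ; rewrite ?subr_ge0.
Qed.

Lemma lemx_scalar n (a b : R) : a <= b -> lemx (a%:C%:M : 'M[C]_n) b%:C%:M.
Proof.
move=> ab; rewrite (scalar_mxZ1 _ a) (scalar_mxZ1 _ b); apply: lemxZr => //.
exact: psd1.
Qed.

Lemma lemx_congr m n (A B : 'M[C]_m) (S : 'M[C]_(m, n)) :
  lemx A B -> lemx (S^t* *m A *m S) (S^t* *m B *m S).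
Proof. by move=> /lemxE h; apply/lemxE; rewrite -mulmxBl -mulmxBr; exact: psd_congr. Qed.

Lemma lemx_qf n (A B : 'M[C]_n) v : lemx A B -> qf A v <= qf B v.
Proof. by move/lemxE/psdP=> [_ /(_ v)]; rewrite qfB subr_ge0. Qed.

Lemma psd_lemx n (A B : 'M[C]_n) : psdmx A -> lemx A B -> psdmx B.
Proof. by move=> pA /lemxE h; rewrite -(subrK A B); exact: psdD. Qed.

Lemma lemxP n (A B : 'M[C]_n) : A^t* = A -> B^t* = B ->
  (forall v, qf A v <= qf B v) -> lemx A B.
Proof.
move=> hA hB h; apply/lemxE/psdP; split; first by rewrite adjB hA hB.
by move=> v; rewrite qfB subr_ge0.
Qed.

(** Closedness of the order, tested on one vector at a time; it removes a multiplicative slack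
    [1 + e]. *)
Lemma lemx_lim n (A B : 'M[C]_n) : A^t* = A -> psdmx B ->
  (forall e : R, 0 < e -> lemx A ((1 + e)%:C *: B)) -> lemx A B.
Proof.
move=> hA pB h; apply: lemxP => //; first exact: psd_herm.
move=> v; have /psdP[_ /(_ v) q0] := pB; apply/ler_addgt0Pr => e e0.
(* With [q = qf B v], the slack [e / (1 + q)] costs [e * q / (1 + q) <= e]; the added 1 covers
   [q = 0]. *)
have e' : 0 < e / (1 + qf B v) by rewrite divr_gt0 // ltr_wpDr.
apply: (le_trans (lemx_qf v (h _ e'))); rewrite qfZ mulrDl mul1r lerD2l.
rewrite mulrAC ler_pdivrMr; last by rewrite ltr_wpDr.
by rewrite ler_wpM2l ?(ltW e0) // lerDr.
Qed.

End Adjoint.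

(** * Spectral functional calculus *)

HB.lock Definition mpow (R : realType) n (A : 'M[R[i]]_n) (r : R) : 'M[R[i]]_n :=
  mxpowR A r.

Definition dg (R : realType) n (d : 'I_n -> R) : 'M[R[i]]_n :=
  diag_mx (\row_i (d i)%:C).

HB.lock Definition sp (R : realType) n (U : 'M[R[i]]_n) (d : 'I_n -> R) : 'M[R[i]]_n :=
  U^t* *m dg d *m U.

Section Spectral.
Context {R : realType}.
Local Notation C := R[i].

Lemma dgE n (d : 'I_n -> R) i j : dg d i j = (d i)%:C *+ (i == j).
Proof. by rewrite !mxE. Qed.

Lemma dg_adj n (d : 'I_n -> R) : (dg d)^t* = dg d.
Proof.
apply/matrixP=> i j; rewrite !mxE eq_sym; case: eqP => [->|_].
  by rewrite !mulr1n conj_real.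
by rewrite !mulr0n conjC0.
Qed.

Lemma dgM n (d e : 'I_n -> R) : dg d *m dg e = dg (fun i => d i * e i).
Proof.
rewrite /dg mulmx_diag; congr diag_mx.
by apply/rowP=> i; rewrite !mxE rmorphM.
Qed.

Lemma dgD n (d e : 'I_n -> R) : dg d + dg e = dg (fun i => d i + e i).
Proof. by apply/matrixP=> i j; rewrite mxE !dgE rmorphD mulrnDl. Qed.

Lemma dg_const n (a : R) : dg (fun=> a) = a%:C%:M :> 'M[C]_n.
Proof. by apply/matrixP=> i j; rewrite dgE !mxE. Qed.

Lemma dgZ n (a : R) (d : 'I_n -> R) : a%:C *: dg d = dg (fun i => a * d i).
Proof. by apply/matrixP=> i j; rewrite mxE !dgE rmorphM mulrnAr. Qed.

Lemma qf_dg n (d : 'I_n -> R) v :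
  qf (dg d) v = \sum_i d i * Normc.normc (v i 0) ^+ 2.
Proof.
apply: complexI; rewrite -herm_form_real ?dg_adj // mxE rmorph_sum.
apply: eq_bigr => i _; rewrite mul_mx_diag !mxE rmorphM rmorphXn /=.
have -> : (Normc.normc (v i 0))%:C = `|v i 0| by [].
by rewrite normCK [X in X * _]mulrC -mulrA [X in _ * X]mulrC.
Qed.

Lemma psd_dg n (d : 'I_n -> R) : (forall i, 0 <= d i) -> psdmx (dg d).
Proof.
move=> h; apply/psdP; split=> [|v]; first exact: dg_adj.
by rewrite qf_dg sumr_ge0 // => i _; rewrite mulr_ge0 ?sqr_ge0.
Qed.

Lemma unitaryK n (U : 'M[C]_n) : U \is unitarymx -> U *m U^t* = 1%:M.
Proof. by move/unitarymxP. Qed.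

Lemma unitaryVK n (U : 'M[C]_n) : U \is unitarymx -> U^t* *m U = 1%:M.
Proof.
by move=> h; rewrite -invmx_unitary // mulVmx // unitarymx_unit.
Qed.

Lemma mulmx_cancel m n p q (A : 'M[C]_(m, n)) (X : 'M[C]_(n, p))
    (Y : 'M[C]_(p, n)) (B : 'M[C]_(n, q)) :
  X *m Y = 1%:M -> A *m X *m (Y *m B) = A *m B.
Proof. by move=> h; rewrite mulmxA -(mulmxA A X Y) h mulmx1. Qed.

Lemma sp_adj n (U : 'M[C]_n) d : (sp U d)^t* = sp U d.
Proof. by rewrite sp.unlock herm_congr // dg_adj. Qed.

Lemma spD n (U : 'M[C]_n) d e : sp U d + sp U e = sp U (fun i => d i + e i).
Proof. by rewrite sp.unlock -mulmxDl -mulmxDr dgD. Qed.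

Lemma spZ n (U : 'M[C]_n) a d : a%:C *: sp U d = sp U (fun i => a * d i).
Proof. by rewrite sp.unlock -dgZ -scalemxAr -scalemxAl. Qed.

Lemma sp_const n (U : 'M[C]_n) a : U \is unitarymx -> sp U (fun=> a) = a%:C%:M.
Proof.
by move=> h; rewrite sp.unlock dg_const scalar_mxC -mulmxA unitaryVK // mulmx1.
Qed.

Lemma spB n (U : 'M[C]_n) d e : sp U d - sp U e = sp U (fun i => d i - e i).
Proof.
apply: (addIr (sp U e)); rewrite subrK spD; congr (sp U _).
by apply/funext=> i; rewrite subrK.
Qed.

Lemma spM n (U : 'M[C]_n) d e : U \is unitarymx ->
  sp U d *m sp U e = sp U (fun i => d i * e i).
Proof.
move=> h; rewrite sp.unlock -dgM -(mulmxA (U^t*) (dg e)) (mulmx_cancel _ _ (unitaryK h)).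
by rewrite !mulmxA.
Qed.

Lemma sp_eigen n (U : 'M[C]_n) d i : U \is unitarymx ->
  sp U d *m col i (U^t*) = (d i)%:C *: col i (U^t*).
Proof.
move=> h; rewrite !colE sp.unlock (mulmx_cancel _ _ (unitaryK h)) -mulmxA scalemxAr.
congr (_ *m _); apply/matrixP=> j k; rewrite mul_diag_mx !mxE.
by have [->|_] := eqVneq j i; rewrite ?mulr0.
Qed.

Lemma qf1_col n (U : 'M[C]_n) i : U \is unitarymx -> qf 1%:M (col i (U^t*)) = 1.
Proof.
move=> h; apply: complexI; rewrite -herm_form_real ?adj1 // mulmx1.
have := unitaryK h => /matrixP/(_ i i); rewrite !mxE eqxx mulr1n => e.
by rewrite -[RHS]e; apply: eq_bigr => k _; rewrite !mxE conjCK.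
Qed.

Lemma qf_sp_col n (U : 'M[C]_n) d i : U \is unitarymx ->
  qf (sp U d) (col i (U^t*)) = d i.
Proof.
move=> h; apply: complexI; rewrite -herm_form_real ?sp_adj //.
rewrite -mulmxA sp_eigen // -scalemxAr mxE -[X in _ * X]/((_ *m _) 0 0).
have := qf1_col i h => e; rewrite -[RHS]mulr1; congr (_ * _).
by rewrite -[X in X *m _]mulmx1 herm_form_real ?adj1 // e.
Qed.

Lemma psd_sp n (U : 'M[C]_n) d : U \is unitarymx ->
  psdmx (sp U d) <-> forall i, 0 <= d i.
Proof.
move=> h; split=> [/psdP[_ p] i|p]; first by rewrite -(qf_sp_col d i h).
by rewrite sp.unlock; apply: psd_congr; exact: psd_dg.
Qed.

Lemma herm_spectral n (A : 'M[C]_n) : A^t* = A ->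
  A = sp (spectralmx A) (fun i => complex.Re (spectral_diag A 0 i)).
Proof.
move=> /hermP hA; have /hermitian_normalmx /orthomx_spectralP {1}-> := hA.
rewrite (invmx_unitary (spectral_unitarymx A)) sp.unlock.
suff -> : diag_mx (spectral_diag A) =
  dg (fun i => complex.Re (spectral_diag A 0 i)) by [].
apply/matrixP=> i j; rewrite dgE mxE RRe_real //.
by have /mxOverP := hermitian_spectral_diag_real hA; exact.
Qed.

Lemma herm_sp n (A : 'M[C]_n) : A^t* = A ->
  exists U, U \is unitarymx /\ exists d, A = sp U d.
Proof.
move=> /herm_spectral hA; exists (spectralmx A); split; last by eexists; exact: hA.
exact: spectral_unitarymx.
Qed.

(* [W := V *m U^t*] intertwines the two diagonal matrices, so [W i j] vanishes
   unless the i-th and j-th diagonal entries agree. *)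
Lemma sp_fun_uniq n (U V : 'M[C]_n) (d e : 'I_n -> R) (f : R -> R) :
  U \is unitarymx -> V \is unitarymx -> sp U d = sp V e ->
  sp U (f \o d) = sp V (f \o e).
Proof.
move=> hU hV h.
have key : V *m U^t* *m dg d = dg e *m (V *m U^t*).
  have : V *m sp U d *m U^t* = V *m sp V e *m U^t* by rewrite h.
  rewrite sp.unlock !mulmxA (unitaryK hV) mul1mx.
  by rewrite -(mulmxA _ U (U^t*)) (unitaryK hU) mulmx1 => ->.
have key2 : V *m U^t* *m dg (f \o d) = dg (f \o e) *m (V *m U^t*).
  move: (V *m U^t*) key => W key; apply/matrixP=> i j.
  have /matrixP/(_ i j) := key.
  rewrite /dg !mul_mx_diag !mul_diag_mx !mxE [RHS]mulrC => hij.
  have [->|nz] := eqVneq (W i j) 0; first by rewrite mul0r mulr0.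
  by rewrite /= (complexI (mulfI nz hij)) mulrC.
have : V^t* *m (V *m U^t* *m dg (f \o d)) *m U =
       V^t* *m (dg (f \o e) *m (V *m U^t*)) *m U by rewrite key2.
rewrite sp.unlock !mulmxA (unitaryVK hV) mul1mx.
by rewrite -(mulmxA _ (U^t*) U) (unitaryVK hU) mulmx1.
Qed.

(** [mxpowR] is tied to the diagonalization by [spectralmx]; [sp_fun_uniq] allows powers to be
    computed in any unitary diagonalization. *)
Lemma mpow_sp n (U : 'M[C]_n) d r : U \is unitarymx ->
  mpow (sp U d) r = sp U (fun i => d i `^ r).
Proof.
move=> hU; set A := sp U d; have hS := spectral_unitarymx A.
have eA := herm_spectral (sp_adj U d : A^t* = A).
rewrite [RHS](sp_fun_uniq (fun x => x `^ r) hU hS eA).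
rewrite mpow.unlock /mxpowR (invmx_unitary hS) sp.unlock.
suff -> : diag_mx (map_mx (fun z => (complex.Re z `^ r)%:C) (spectral_diag A)) =
  dg ((fun x => x `^ r) \o (fun i => complex.Re (spectral_diag A 0 i))) by [].
by apply/matrixP=> i j; rewrite dgE !mxE.
Qed.

Lemma sp_congr n (U T : 'M[C]_n) d : T^t* *m sp U d *m T = sp (U *m T) d.
Proof. by rewrite sp.unlock adjM !mulmxA. Qed.

Lemma mpow_herm n (A : 'M[C]_n) r : A^t* = A -> (mpow A r)^t* = mpow A r.
Proof. by move=> /herm_sp[U [hU [d ->]]]; rewrite (mpow_sp _ _ hU) sp_adj. Qed.

Lemma mpow_psd n (A : 'M[C]_n) r : A^t* = A -> psdmx (mpow A r).
Proof.
move=> /herm_sp[U [hU [d ->]]]; rewrite (mpow_sp _ _ hU).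
by apply/psd_sp => // i; exact: powR_ge0.
Qed.

Lemma mpow_unitary n (A T : 'M[C]_n) r : A^t* = A -> T \is unitarymx ->
  mpow (T^t* *m A *m T) r = T^t* *m mpow A r *m T.
Proof.
move=> /herm_sp[U [hU [d ->]]] hT; rewrite sp_congr mpow_sp; last exact: mul_unitarymx.
by rewrite (mpow_sp _ _ hU) sp_congr.
Qed.

Lemma psd_spP n (A : 'M[C]_n) : psdmx A ->
  exists U, U \is unitarymx /\ exists d, (forall i, 0 <= d i) /\ A = sp U d.
Proof.
move=> pA; have [U [hU [d eA]]] := herm_sp (psd_herm pA).
exists U; split=> //; exists d; split=> //.
by apply/(psd_sp d hU); rewrite -eA.
Qed.

Lemma mpow_psdK n (A : 'M[C]_n) r : r != 0 -> psdmx A ->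
  mpow (mpow A r) r^-1 = A.
Proof.
move=> r0 /psd_spP[U [hU [d [d0 ->]]]]; rewrite !(mpow_sp _ _ hU); congr (sp U _).
by apply/funext=> i; rewrite -powRrM mulfV // powRr1.
Qed.

Lemma mpow_scale n (A : 'M[C]_n) (a r : R) : 0 <= a -> psdmx A ->
  mpow (a%:C *: A) r = (a `^ r)%:C *: mpow A r.
Proof.
move=> a0 /psd_spP[U [hU [d [d0 ->]]]]; rewrite spZ !(mpow_sp _ _ hU) spZ.
by congr (sp U _); apply/funext=> i; rewrite powRM.
Qed.

Lemma mpow1 n (A : 'M[C]_n) : psdmx A -> mpow A 1 = A.
Proof.
move=> /psd_spP[U [hU [d [d0 ->]]]]; rewrite (mpow_sp _ _ hU).
by congr (sp U _); apply/funext=> i; rewrite powRr1.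
Qed.

Lemma mpow0 n (A : 'M[C]_n) : A^t* = A -> mpow A 0 = 1%:M.
Proof.
move=> /herm_sp[U [hU [d ->]]]; rewrite (mpow_sp _ _ hU).
rewrite -[RHS](sp_const 1 hU).
by congr (sp U _); apply/funext=> i; rewrite powRr0.
Qed.

(** For a positive semidefinite matrix, invertibility means that all eigenvalues are positive
    ([pd_sp]). *)
Definition pdmx n (A : 'M[C]_n) := psdmx A /\ A \in unitmx.

Lemma unit_dg n (d : 'I_n -> R) : (dg d \in unitmx) = [forall i, d i != 0].
Proof.
rewrite unitmxE det_diag unitfE; apply/idP/forallP => [h i|h].
  move: h; rewrite (bigD1 i) //= mulf_eq0 negb_or => /andP[+ _].
  by rewrite mxE; apply: contra => /eqP ->.
apply/prodf_neq0 => i _; rewrite mxE; apply: contra (h i) => /eqP e.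
by apply/eqP/complexI.
Qed.

Lemma unit_sp n (U : 'M[C]_n) d : U \is unitarymx ->
  (sp U d \in unitmx) = [forall i, d i != 0].
Proof.
move=> h; have h' : U^t* \is unitarymx by rewrite trmxC_unitary.
by rewrite sp.unlock !unitmx_mul unit_dg (unitarymx_unit h) (unitarymx_unit h') andbT.
Qed.

Lemma pd_sp n (U : 'M[C]_n) d : U \is unitarymx ->
  pdmx (sp U d) <-> forall i, 0 < d i.
Proof.
move=> h; split=> [[/(psd_sp d h) p]|p].
  by rewrite unit_sp // => /forallP u i; rewrite lt_def u p.
split; first by apply/(psd_sp d h) => i; exact: ltW.
by rewrite unit_sp //; apply/forallP=> i; rewrite gt_eqF.
Qed.

Lemma pd_spP n (A : 'M[C]_n) : pdmx A ->
  exists U, U \is unitarymx /\ exists d, (forall i, 0 < d i) /\ A = sp U d.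
Proof.
move=> pA; have [U [hU [d eA]]] := herm_sp (psd_herm pA.1).
by exists U; split=> //; exists d; split=> //; apply/(pd_sp d hU); rewrite -eA.
Qed.

Lemma pd_herm n (A : 'M[C]_n) : pdmx A -> A^t* = A.
Proof. by case=> /psd_herm. Qed.

Lemma pd_pow n (A : 'M[C]_n) r : pdmx A -> pdmx (mpow A r).
Proof.
move=> /pd_spP[U [hU [d [d0 ->]]]]; rewrite (mpow_sp _ _ hU).
by apply/pd_sp => // i; exact: powR_gt0.
Qed.

Lemma mpowD n (A : 'M[C]_n) r s : pdmx A ->
  mpow A r *m mpow A s = mpow A (r + s).
Proof.
move=> /pd_spP[U [hU [d [d0 ->]]]]; rewrite !(mpow_sp _ _ hU) spM //.
by congr (sp U _); apply/funext=> i; rewrite powRD // (gt_eqF (d0 i)) implybT.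
Qed.

Lemma mpowM n (A : 'M[C]_n) r s : A^t* = A ->
  mpow (mpow A r) s = mpow A (r * s).
Proof.
move=> /herm_sp[U [hU [d ->]]]; rewrite (mpow_sp d r hU).
rewrite (mpow_sp _ s hU) (mpow_sp _ _ hU).
by congr (sp U _); apply/funext=> i; rewrite powRrM.
Qed.

Lemma mpowVK n (A : 'M[C]_n) r : pdmx A -> mpow A r *m mpow A (- r) = 1%:M.
Proof. by move=> pA; rewrite mpowD // subrr mpow0 // pd_herm. Qed.

Lemma mpowKV n (A : 'M[C]_n) r : pdmx A -> mpow A (- r) *m mpow A r = 1%:M.
Proof. by move=> pA; rewrite mpowD // addNr mpow0 // pd_herm. Qed.

Lemma pd_congr n (A S : 'M[C]_n) : S \in unitmx -> pdmx A ->
  pdmx (S^t* *m A *m S).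
Proof.
move=> uS [pA uA]; split; first exact: psd_congr.
rewrite !unitmx_mul uA uS !andbT /=.
by rewrite map_unitmx unitmx_tr.
Qed.

Lemma pd_qf_gt0 n (A : 'M[C]_n) v : pdmx A -> v != 0 -> 0 < qf A v.
Proof.
move=> /pd_spP[U [hU [d [d0 ->]]]] v0; rewrite sp.unlock qf_congr.
have : 0 < qf 1%:M (U *m v).
  by rewrite -qf_congr mulmx1 unitaryVK // qf1_gt0.
rewrite qf1E qf_dg => h; rewrite lt_def sumr_ge0 ?andbT; last first.
  by move=> i _; rewrite mulr_ge0 ?sqr_ge0 ?ltW.
apply: contraTN h; rewrite psumr_eq0 => [/allP h|i _]; last first.
  by rewrite mulr_ge0 ?sqr_ge0 ?ltW.
rewrite -leNgt big1 // => i _; have := h i (mem_index_enum _).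
by rewrite mulf_eq0 gt_eqF //= => /eqP.
Qed.

Lemma qf_gt0_pd n (A : 'M[C]_n) : A^t* = A ->
  (forall v, v != 0 -> 0 < qf A v) -> pdmx A.
Proof.
move=> /herm_sp[U [hU [d ->]]] h; apply/pd_sp => // i.
rewrite -(qf_sp_col d i hU); apply: h; apply: contra_eq_neq (qf1_col i hU) => /= ->.
by rewrite qf_vec0 eq_sym oner_eq0.
Qed.

Lemma pd_lemx n (A B : 'M[C]_n) : pdmx A -> lemx A B -> pdmx B.
Proof.
move=> pA h; have pB := psd_lemx pA.1 h.
apply: qf_gt0_pd => [|v v0]; first exact: psd_herm.
exact: lt_le_trans (pd_qf_gt0 pA v0) (lemx_qf v h).
Qed.

Lemma pd1 n : pdmx (1%:M : 'M[C]_n).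
Proof. by split; [exact: psd1 | exact: unitmx1]. Qed.

Lemma pdZ n (a : R) (A : 'M[C]_n) : 0 < a -> pdmx A -> pdmx (a%:C *: A).
Proof.
move=> a0 /pd_spP[U [hU [d [d0 ->]]]]; rewrite spZ; apply/pd_sp => // i.
exact: mulr_gt0.
Qed.

Lemma pd_scalar n (a : R) : 0 < a -> pdmx (a%:C%:M : 'M[C]_n).
Proof. by move=> a0; rewrite scalar_mxZ1; apply: pdZ => //; exact: pd1. Qed.

Lemma psd_pdD n (A B : 'M[C]_n) : psdmx A -> pdmx B -> pdmx (A + B).
Proof. by move=> pA pB; apply: (pd_lemx pB); rewrite lemx.unlock addrK. Qed.

Lemma pd_ge_scalar n (A : 'M[C]_n) : pdmx A ->
  exists2 m : R, 0 < m & lemx m%:C%:M A.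
Proof.
move=> /pd_spP[U [hU [d [d0 ->]]]].
have [m m0 hm] : exists2 m : R, 0 < m & forall i, m <= d i.
  (* The default 1 keeps the minimum positive, also when [n = 0]. *)
  exists (\big[Num.min/1]_i d i); first by apply: lt_bigmin.
  by move=> i; exact: bigmin_le_cond.
exists m => //; rewrite -(sp_const m hU) lemx.unlock spB; apply/psd_sp => // i.
by rewrite subr_ge0.
Qed.

Lemma psd_le_scalar n (A : 'M[C]_n) : A^t* = A ->
  exists2 m : R, 0 < m & lemx A m%:C%:M.
Proof.
move=> /herm_sp[U [hU [d ->]]].
have [m m0 hm] : exists2 m : R, 0 < m & forall i, d i <= m.
  exists (\big[Num.max/1]_i d i); first by apply: lt_le_trans ltr01 (bigmax_ge_id _ _ _ _).
  by move=> i; exact: le_bigmax_cond.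
exists m => //; rewrite -(sp_const m hU) lemx.unlock spB; apply/psd_sp => // i.
by rewrite subr_ge0.
Qed.

End Spectral.

(** * Jensen's inequality for positive maps *)

Section Jensen.
Context {R : realType}.
Local Notation C := R[i].

Lemma ReD (x y : C) : complex.Re (x + y) = complex.Re x + complex.Re y.
Proof. by case: x => ? ?; case: y. Qed.

Lemma ReZ (a : R) (x : C) : complex.Re (a%:C * x) = a * complex.Re x.
Proof. by case: x => x y /=; rewrite mul0r subr0. Qed.

Lemma bfD n (A B : 'M[C]_n) u v : bf (A + B) u v = bf A u v + bf B u v.
Proof. by rewrite bf.unlock mulmxDr mulmxDl mxE ReD. Qed.

Lemma bfZ n a (A : 'M[C]_n) u v : bf (a%:C *: A) u v = a * bf A u v.
Proof. by rewrite bf.unlock -scalemxAr -scalemxAl mxE ReZ. Qed.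

Lemma bf_sum n (I : finType) (F : I -> 'M[C]_n) u v :
  bf (\sum_i F i) u v = \sum_i bf (F i) u v.
Proof.
apply: (big_morph (fun X => bf X u v)) => [X Y|]; first exact: bfD.
by rewrite bf.unlock mulmx0 mul0mx mxE.
Qed.

Lemma bf_sym n (A : 'M[C]_n) u v : A^t* = A -> bf A u v = bf A v u.
Proof.
move=> hA; rewrite bf.unlock.
have -> : v^t* *m A *m u = (u^t* *m A *m v)^t*.
  by rewrite !adjM trmxCK hA mulmxA.
by rewrite !mxE; case: (\sum_(_ < _) _).
Qed.

Lemma ReN (x : C) : complex.Re (- x) = - complex.Re x.
Proof. by case: x. Qed.

Lemma bfBl n (A : 'M[C]_n) u v w : bf A (u - v) w = bf A u w - bf A v w.
Proof.
rewrite bf.unlock adjB !mulmxBl; move: (_ *m w) (_ *m w) => X Y.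
by rewrite !mxE ReD ReN.
Qed.

Lemma bfBr n (A : 'M[C]_n) u v w : bf A w (u - v) = bf A w u - bf A w v.
Proof.
rewrite bf.unlock mulmxBr; move: (_ *m u) (_ *m v) => X Y.
by rewrite !mxE ReD ReN.
Qed.

Lemma bfZl n (A : 'M[C]_n) a u v : bf A (a%:C *: u) v = a * bf A u v.
Proof.
rewrite bf.unlock adjZ -!scalemxAl; move: (_ *m v) => X.
by rewrite mxE ReZ.
Qed.

Lemma bfZr n (A : 'M[C]_n) a u v : bf A u (a%:C *: v) = a * bf A u v.
Proof.
rewrite bf.unlock -scalemxAr; move: (_ *m v) => X.
by rewrite mxE ReZ.
Qed.

Lemma bf_combo n (A : 'M[C]_n) (p q : R) u v :
  qf A (p%:C *: u - q%:C *: v) =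
    p ^+ 2 * bf A u u + q ^+ 2 * bf A v v - p * q * bf A u v - p * q * bf A v u.
Proof.
set x := p%:C *: u; set y := q%:C *: v.
rewrite qfE (bfBl A x y) (bfBr A x y x) (bfBr A x y y).
rewrite !(bfZl A p u) !(bfZl A q v) !(bfZr A p _ u) !(bfZr A q _ v).
ring.
Qed.

Lemma sp_sum n (U : 'M[C]_n) f :
  sp U f = \sum_i (f i)%:C *: sp U (fun j => (j == i)%:R).
Proof.
have -> : \sum_i (f i)%:C *: sp U (fun j => (j == i)%:R) =
   U^t* *m (\sum_i (f i)%:C *: dg (fun j => (j == i)%:R)) *m U.
  rewrite mulmx_sumr mulmx_suml; apply: eq_bigr => i _.
  by rewrite sp.unlock -scalemxAr -scalemxAl.
rewrite sp.unlock; suff -> : dg f = \sum_i (f i)%:C *: dg (fun j => (j == i)%:R) by [].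
apply/matrixP=> i j; rewrite dgE summxE (bigD1 i) //= big1 => [|k ki].
  by rewrite mxE dgE eqxx addr0 rmorph1 mulrnAr mulr1.
by rewrite mxE dgE eq_sym (negbTE ki) rmorph0 mul0rn mulr0.
Qed.

Lemma one_powR (s : R) : 1 `^ s = 1.
Proof. by rewrite powR1. Qed.

(* If y solves G y = mu D^((s+t)/2) y, testing the block inequality on
   u = D^((t-s)/2) y and v = y gives (a + b - 2 mu) <y, D^t y> >= 0. *)
Lemma pencil_le l (D P Q G : 'M[C]_l) (a b s t : R) :
  pdmx D -> G^t* = G ->
  (forall u v, 0 <= qf P u + qf Q v - bf G u v - bf G v u) ->
  lemx P (a%:C *: mpow D s) -> lemx Q (b%:C *: mpow D t) ->
  lemx G (((a + b) / 2)%:C *: mpow D ((s + t) / 2)).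
Proof.
move=> pD hG block hP hQ; have [g Eg] : exists g, (s + t) / 2 = g by eexists.
have [c Ec] : exists c, (a + b) / 2 = c by eexists.
rewrite Eg Ec.
have hD := pd_herm pD.
set S := mpow D (- (g / 2)); set T := mpow D (g / 2).
have hS : S^t* = S by exact: mpow_herm.
have hT : T^t* = T by exact: mpow_herm.
have TS : T *m S = 1%:M by exact: mpowVK.
have ST : S *m T = 1%:M by exact: mpowKV.
have TT : T *m T = mpow D g by rewrite (mpowD _ _ pD) -splitr.
(* It suffices to bound the eigenvalues of [S G S]: an eigenvector [z] gives [y = S z] with
   [G y = mu D^g y], and the congruence by [T] at the end undoes [S]. *)
have [V [hV [mu eK]]] := herm_sp (herm_congr S hG).
have mu_le i : mu i <= c.
  set z := col i (V^t*); set y := S *m z.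
  have Ty : T *m y = z by rewrite mulmxA TS mul1mx.
  have Gy : G *m y = (mu i)%:C *: (mpow D g *m y).
    have : S *m (G *m y) = (mu i)%:C *: z.
      by rewrite -sp_eigen // -eK hS /y !mulmxA.
    move=> /(congr1 (mulmx T)); rewrite mulmxA TS mul1mx => ->.
    by rewrite -TT -scalemxAr -mulmxA Ty.
  have y0 : y != 0.
    apply: contra_eq_neq (qf1_col i hV) => /= y0.
    by rewrite -/z -Ty y0 mulmx0 qf_vec0 eq_sym oner_eq0.
  clearbody z y.
  have [w Ew] : exists w, (t - s) / 2 = w by eexists.
  set W := mpow D w; set u := W *m y.
  have hW : W^t* = W by exact: mpow_herm.
  set q := qf (mpow D t) y.
  have q0 : 0 < q by exact: (pd_qf_gt0 (pd_pow _ pD) y0).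
  have qP : qf P u <= a * q.
    apply: (le_trans (lemx_qf u hP)); rewrite qfZ /u -qf_congr hW !(mpowD _ _ pD).
    suff -> : w + s + w = t by [].
    by rewrite -Ew; lra.
  have qQ : qf Q y <= b * q by apply: (le_trans (lemx_qf y hQ)); rewrite qfZ.
  have bG : bf G u y = mu i * q.
    rewrite bf.unlock -mulmxA Gy -scalemxAr mxE ReZ /u adjM hW !mulmxA.
    rewrite -(mulmxA _ W) (mpowD _ _ pD).
    have -> : w + g = t by rewrite -Ew -Eg; lra.
    by rewrite /q /qf bf.unlock.
  have := block u y; rewrite (bf_sym y u hG) bG => h.
  have : 0 <= (c - mu i) * q.
    have -> : (c - mu i) * q = (a * q + b * q - mu i * q - mu i * q) / 2.
      by rewrite -Ec; field.
    by apply: divr_ge0 => //; apply: (le_trans h); lra.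
  by rewrite pmulr_lge0 // subr_ge0.
have : lemx (S^t* *m G *m S) c%:C%:M.
  rewrite eK -(sp_const c hV) lemx.unlock spB; apply/psd_sp => // i.
  by rewrite subr_ge0.
move=> /(lemx_congr T); rewrite hT hS mul_mx_scalar -scalemxAl TT.
suff -> : T *m (S *m G *m S) *m T = G by [].
by rewrite !mulmxA TS mul1mx -mulmxA ST mulmx1.
Qed.

Section PositiveMap.
Variables (n l : nat) (Phi : {linear 'M[C]_n -> 'M[C]_l}).
Hypothesis hPhi : positive_map Phi.

Lemma pos_lemx A B : lemx A B -> lemx (Phi A) (Phi B).
Proof. by rewrite lemx.unlock => /hPhi; rewrite linearB. Qed.

(** Positivity of the block matrix with diagonal [Phi(A^s)], [Phi(A^t)] and off-diagonal
    [-Phi(A^((s+t)/2))]. Positivity of [Phi] yields it because the three powers combine the same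
    spectral projections of [A]: with their images [E i], the expression is the sum over [i] of the
    form [E i] at [d_i^(s/2) u - d_i^(t/2) v]. *)
Lemma pos_block A (s t : R) u v : psdmx A -> 0 <= s -> 0 <= t ->
  0 <= qf (Phi (mpow A s)) u + qf (Phi (mpow A t)) v
       - bf (Phi (mpow A ((s + t) / 2))) u v
       - bf (Phi (mpow A ((s + t) / 2))) v u.
Proof.
move=> /psd_spP[U [hU [d [d0 ->]]]] s0 t0.
rewrite !(mpow_sp _ _ hU).
pose E i := Phi (sp U (fun j => (j == i)%:R)).
have pE i : psdmx (E i).
  by apply: hPhi; apply/psd_sp => // j; exact: ler0n.
have eP f : Phi (sp U f) = \sum_i (f i)%:C *: E i.
  by rewrite sp_sum linear_sum; apply: eq_bigr => i _; rewrite linearZ.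
have eB f x y : bf (Phi (sp U f)) x y = \sum_i f i * bf (E i) x y.
  by rewrite eP bf_sum; apply: eq_bigr => i _; rewrite bfZ.
clearbody E; rewrite !qfE !eB.
rewrite -big_split -!sumrB /=; apply: sumr_ge0 => i _.
have ps : d i `^ s = (d i `^ (s / 2)) ^+ 2.
  by rewrite -powR_mulrn ?powR_ge0 // -powRrM; congr (_ `^ _); field.
have pt : d i `^ t = (d i `^ (t / 2)) ^+ 2.
  by rewrite -powR_mulrn ?powR_ge0 // -powRrM; congr (_ `^ _); field.
(* Since [d i] may be 0, the addition law for exponents is applied only with a nonzero total
   exponent; zero exponents are split off. *)
have pg : d i `^ ((s + t) / 2) = d i `^ (s / 2) * d i `^ (t / 2).
  have [s00|s00] := eqVneq s 0.
    by rewrite s00 add0r mul0r powRr0 mul1r.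
  have [t00|t00] := eqVneq t 0.
    by rewrite t00 addr0 mul0r powRr0 mulr1.
  rewrite -powRD ?mulrDl //; apply/implyP; rewrite paddr_eq0 ?divr_ge0 //.
  by rewrite mulf_eq0 (negbTE s00) invr_eq0 pnatr_eq0.
rewrite ps pt pg -bf_combo.
by case/psdP: (pE i).
Qed.

Lemma pos_mid A D (a b s t : R) : psdmx A -> pdmx D -> 0 <= s -> 0 <= t ->
  lemx (Phi (mpow A s)) (a%:C *: mpow D s) ->
  lemx (Phi (mpow A t)) (b%:C *: mpow D t) ->
  lemx (Phi (mpow A ((s + t) / 2))) (((a + b) / 2)%:C *: mpow D ((s + t) / 2)).
Proof.
move=> pA pD s0 t0; apply: pencil_le => //.
  by apply: psd_herm; apply: hPhi; apply: mpow_psd; exact: psd_herm.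
by move=> u v; exact: pos_block.
Qed.

(** The crude constant from which the halving in [pos_jensen] starts. For [s] in [0, 1],
    [min(1, d) <= d^s <= max(1, d)], so one ratio [M / m] serves all exponents at once. *)
Lemma pos_bound A D : psdmx A -> pdmx D -> lemx (Phi 1%:M) 1%:M ->
  exists2 x : R, 0 <= x & forall s, 0 <= s <= 1 ->
    lemx (Phi (mpow A s)) ((1 + x)%:C *: mpow D s).
Proof.
move=> pA pD h1.
have [M M0 hM] : exists2 M : R, 1 <= M & forall s, 0 <= s <= 1 ->
    lemx (mpow A s) M%:C%:M.
  move: pA => /psd_spP[U [hU [d [d0 ->]]]].
  exists (\big[Num.max/1]_i d i); first exact: bigmax_ge_id.
  move=> s /andP[s0 s1]; rewrite (mpow_sp _ _ hU) -(sp_const _ hU) lemx.unlock spB.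
  apply/psd_sp => // i; rewrite subr_ge0.
  have [d1|d1] := leP 1 (d i).
    by apply: (@le_trans _ _ (d i)); [exact: ler1_powR | exact: le_bigmax_cond].
  apply: (@le_trans _ _ 1); last exact: bigmax_ge_id.
  by rewrite -[leRHS](one_powR s); apply: ge0_ler_powR; rewrite ?nnegrE // ltW.
have [m m0 hm] : exists2 m : R, 0 < m <= 1 & forall s, 0 <= s <= 1 ->
    lemx m%:C%:M (mpow D s).
  move: pD => /pd_spP[U [hU [d [d0 ->]]]].
  exists (\big[Num.min/1]_i d i).
    by rewrite lt_bigmin //= bigmin_le_id.
  move=> s /andP[s0 s1]; rewrite (mpow_sp _ _ hU) -(sp_const _ hU) lemx.unlock spB.
  apply/psd_sp => // i; rewrite subr_ge0.
  have [d1|d1] := leP 1 (d i).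
    apply: (@le_trans _ _ 1); first exact: bigmin_le_id.
    by rewrite -[leLHS](one_powR s); apply: ge0_ler_powR; rewrite ?nnegrE // ltW.
  apply: (@le_trans _ _ (d i)); first exact: bigmin_le_cond.
  by apply: ger1_powR => //; rewrite d0 ltW.
have /andP[m0' m1] := m0.
exists (M / m - 1).
  by rewrite subr_ge0 ler_pdivlMr // mul1r (le_trans m1).
move=> s s01; rewrite addrC subrK.
apply: (@lemx_trans _ _ (M%:C *: 1%:M)).
  apply: (@lemx_trans _ _ (M%:C *: Phi 1%:M)).
    by rewrite -linearZ -scalar_mxZ1; apply: pos_lemx; exact: hM.
  by apply: lemxZ => //; exact: le_trans M0.
have -> : M%:C *: 1%:M = (M / m)%:C *: m%:C%:M :> 'M[C]_l.
  by rewrite (scalar_mxZ1 _ m) scalerA -rmorphM divfK ?gt_eqF.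
by apply: lemxZ; [rewrite divr_ge0 ?ltW // (lt_le_trans ltr01) | exact: hm].
Qed.

(* If [1 + x] is an admissible constant for all exponents at once, then so is
   [1 + x / 2]: every s in [0, 1] is the midpoint of 0 and 2s or of 2s - 1 and
   1, and at the endpoints 0 and 1 the constant 1 is admissible. *)
Theorem pos_jensen A D (s : R) : psdmx A -> pdmx D ->
  lemx (Phi 1%:M) 1%:M -> lemx (Phi A) D -> 0 <= s <= 1 ->
  lemx (Phi (mpow A s)) (mpow D s).
Proof.
move=> pA pD h1 hA s01.
have hhalf x : 0 <= x -> (forall s, 0 <= s <= 1 ->
    lemx (Phi (mpow A s)) ((1 + x)%:C *: mpow D s)) ->
  (forall s, 0 <= s <= 1 ->
    lemx (Phi (mpow A s)) ((1 + x / 2)%:C *: mpow D s)).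
  move=> x0 h {s01}s /andP[s0 s1]; have [s2|s2] := leP s (1 / 2).
    have -> : s = (0 + 2 * s) / 2 by field.
    have -> : 1 + x / 2 = (1 + (1 + x)) / 2 by field.
    apply: (pos_mid pA pD) => [|||]; [by []|by lra| |by apply: h; lra].
    (* At exponent 0 the bound is the hypothesis [Phi 1 <= 1]; at exponent 1, in the other half, it
       is [Phi A <= D]. *)
    by rewrite (mpow0 (psd_herm pA)) (mpow0 (pd_herm pD)) scale1r.
  have -> : s = (2 * s - 1 + 1) / 2 by field.
  have -> : 1 + x / 2 = ((1 + x) + 1) / 2 by field.
  apply: (pos_mid pA pD) => [|||]; [by lra|by []|by apply: h; lra|].
  by rewrite scale1r (mpow1 pA) (mpow1 pD.1).
have [x x0 hx] := pos_bound pA pD h1.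
have hk k : forall s, 0 <= s <= 1 ->
    lemx (Phi (mpow A s)) ((1 + x / 2 ^+ k)%:C *: mpow D s).
  elim: k => [|k IH]; first by rewrite expr0 divr1.
  by rewrite exprSr invfM mulrA; apply: hhalf => //; rewrite divr_ge0 ?exprn_ge0.
have hD : psdmx (mpow D s) by apply: mpow_psd; exact: pd_herm.
apply: (lemx_lim _ hD) => [|e e0].
  by apply: psd_herm; apply: hPhi; apply: mpow_psd; exact: psd_herm.
have [k hke] : exists k, x / 2 ^+ k <= e.
  exists (Num.bound (x / e)); rewrite ler_pdivrMr ?exprn_gt0 // mulrC.
  rewrite -ler_pdivrMr //; have := archi_boundP (divr_ge0 x0 (ltW e0)).
  move/ltW/le_trans; apply; rewrite -natrX ler_nat ltnW //.
  by rewrite ltn_expl.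
apply: (lemx_trans (hk k s s01)); apply: lemxZr => //.
by rewrite lerD2l.
Qed.

End PositiveMap.
End Jensen.

(** * The geometric mean and the Ando-Hiai inequality *)

HB.lock Definition gm (R : realType) n (a : R) (A B : 'M[R[i]]_n) : 'M[R[i]]_n :=
  mpow A (1 / 2) *m mpow (mpow A (- (1 / 2)) *m B *m mpow A (- (1 / 2))) a
    *m mpow A (1 / 2).

Section GeometricMean.
Context {R : realType}.
Local Notation C := R[i].

Lemma gmE n a (A B : 'M[C]_n) : geomean_pd a A B = gm a A B.
Proof. by rewrite gm.unlock mpow.unlock. Qed.

(** Congruences are packaged as linear maps so that [pos_jensen] applies to them; the condition
    [Phi 1 <= 1] then says that [S] is a contraction. *)
Definition congr_map m n (S : 'M[C]_(m, n)) : {linear 'M[C]_m -> 'M[C]_n} :=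
  mulmxr S \o mulmx (S^t*).

Lemma congr_mapE m n (S : 'M[C]_(m, n)) A : congr_map S A = S^t* *m A *m S.
Proof. by []. Qed.

Lemma congr_positive m n (S : 'M[C]_(m, n)) : positive_map (congr_map S).
Proof. by move=> A /= pA; exact: (psd_congr S pA). Qed.

Section Half.
Variables (n : nat) (A : 'M[C]_n).
Hypothesis pA : pdmx A.
Let X := mpow A (1 / 2).
Let Y := mpow A (- (1 / 2)).

Lemma halfXY : X *m Y = 1%:M. Proof. exact: mpowVK. Qed.
Lemma halfYX : Y *m X = 1%:M. Proof. exact: mpowKV. Qed.
Lemma halfXX : X *m X = A.
Proof. by rewrite (mpowD _ _ pA) -splitr; exact: (mpow1 pA.1). Qed.
Lemma halfX_herm : X^t* = X. Proof. exact: (mpow_herm _ (pd_herm pA)). Qed.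
Lemma halfY_herm : Y^t* = Y. Proof. exact: (mpow_herm _ (pd_herm pA)). Qed.
Lemma halfX_unit : X \in unitmx. Proof. by case: (pd_pow (1 / 2) pA). Qed.
Lemma halfY_unit : Y \in unitmx. Proof. by case: (pd_pow (- (1 / 2)) pA). Qed.
Lemma halfYAY : Y *m A *m Y = 1%:M.
Proof. by rewrite -[X in Y *m X]halfXX mulmxA halfYX mul1mx halfXY. Qed.
Lemma halfXK m (M : 'M[C]_(n, m)) : X *m (Y *m M) = M.
Proof. by rewrite mulmxA halfXY mul1mx. Qed.
Lemma pd_halfX B : pdmx B -> pdmx (X *m B *m X).
Proof. by move=> pB; rewrite -{1}halfX_herm; exact: (pd_congr halfX_unit pB). Qed.
Lemma pd_halfY B : pdmx B -> pdmx (Y *m B *m Y).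
Proof. by move=> pB; rewrite -{1}halfY_herm; exact: (pd_congr halfY_unit pB). Qed.
Lemma lemx_halfX M N : lemx M N -> lemx (X *m M *m X) (X *m N *m X).
Proof. by move=> /(lemx_congr X); rewrite halfX_herm. Qed.
Lemma lemx_halfY M N : lemx M N -> lemx (Y *m M *m Y) (Y *m N *m Y).
Proof. by move=> /(lemx_congr Y); rewrite halfY_herm. Qed.

End Half.

Lemma gm_pd n a (A B : 'M[C]_n) : pdmx A -> pdmx B -> pdmx (gm a A B).
Proof.
move=> pA pB; rewrite gm.unlock; apply: (pd_halfX pA).
by apply: pd_pow; exact: (pd_halfY pA pB).
Qed.

Lemma mpow_loewner n (A D : 'M[C]_n) s : psdmx A -> pdmx D -> lemx A D ->
  0 <= s <= 1 -> lemx (mpow A s) (mpow D s).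
Proof.
move=> pA pD AD s01.
have e M : congr_map (1%:M : 'M[C]_n) M = M.
  by rewrite congr_mapE adj1 mul1mx mulmx1.
rewrite -[X in lemx X _](e (mpow A s)).
apply: (pos_jensen (congr_positive _) pA pD _ _ s01); rewrite e.
  exact: lemxx.
exact: AD.
Qed.

(** For [S = A^(1/2) A'^(-1/2)], the inequality [A <= A'] says that [S] is a contraction, and
    [B <= B'] says that congruence by [S] sends [A^(-1/2) B A^(-1/2)] below its primed analogue.
    Jensen's inequality for this congruence and the power [a], followed by congruence with
    [A'^(1/2)], gives the claim. *)
Lemma gm_mono n a (A B A' B' : 'M[C]_n) : 0 <= a <= 1 -> pdmx A -> pdmx B ->
  lemx A A' -> lemx B B' -> lemx (gm a A B) (gm a A' B').
Proof.
move=> a01 pA pB hA hB; have pA' := pd_lemx pA hA; have pB' := pd_lemx pB hB.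
pose S := mpow A (1 / 2) *m mpow A' (- (1 / 2)).
have hS : S^t* = mpow A' (- (1 / 2)) *m mpow A (1 / 2).
  by rewrite adjM (halfX_herm pA) (halfY_herm pA').
have e M : congr_map S M =
    mpow A' (- (1 / 2)) *m (mpow A (1 / 2) *m M *m mpow A (1 / 2))
      *m mpow A' (- (1 / 2)).
  by rewrite congr_mapE hS /S !mulmxA.
have pC := pd_halfY pA pB; have pC' := pd_halfY pA' pB'.
have e1 : congr_map S 1%:M = mpow A' (- (1 / 2)) *m A *m mpow A' (- (1 / 2)).
  by rewrite e mulmx1 (halfXX pA).
have eC : congr_map S (mpow A (- (1 / 2)) *m B *m mpow A (- (1 / 2))) =
    mpow A' (- (1 / 2)) *m B *m mpow A' (- (1 / 2)).
  rewrite e; suff -> : mpow A (1 / 2) *m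
    (mpow A (- (1 / 2)) *m B *m mpow A (- (1 / 2))) *m mpow A (1 / 2) = B by [].
  by rewrite !mulmxA (halfXY pA) mul1mx -mulmxA (halfYX pA) mulmx1.
have h1 : lemx (congr_map S 1%:M) 1%:M.
  by rewrite e1 -(halfYAY pA'); exact: (lemx_halfY pA' hA).
have hC : lemx (congr_map S (mpow A (- (1 / 2)) *m B *m mpow A (- (1 / 2))))
    (mpow A' (- (1 / 2)) *m B' *m mpow A' (- (1 / 2))).
  by rewrite eC; exact: (lemx_halfY pA' hB).
have := lemx_halfX pA' (pos_jensen (congr_positive S) pC.1 pC' h1 hC a01).
rewrite e gm.unlock -!mulmxA (halfXK pA') !mulmxA.
by rewrite -(mulmxA _ (mpow A' (- (1 / 2)))) (halfYX pA') mulmx1.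
Qed.

(* T = A^(1/2) S A'^(-1/2), with A' = S^* A S, is unitary and conjugates
   A^(-1/2) B A^(-1/2) into its analogue for the congruent pair. *)
Lemma gm_congr n a (A B S : 'M[C]_n) : pdmx A -> pdmx B -> S \in unitmx ->
  gm a (S^t* *m A *m S) (S^t* *m B *m S) = S^t* *m gm a A B *m S.
Proof.
move=> pA pB uS; set A' := S^t* *m A *m S.
have pA' : pdmx A' by exact: pd_congr.
set X := mpow A (1 / 2); set X' := mpow A' (1 / 2).
set Y := mpow A (- (1 / 2)); set Y' := mpow A' (- (1 / 2)).
pose T := X *m S *m Y'.
have hT : T^t* = Y' *m S^t* *m X.
  by rewrite !adjM (halfX_herm pA) (halfY_herm pA') mulmxA.
have uT : T \is unitarymx.
  rewrite -trmxC_unitary; apply/unitarymxP; rewrite trmxCK hT /T.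
  rewrite -(halfYAY pA') -/Y' /A' !mulmxA -(mulmxA _ X X) (halfXX pA).
  reflexivity.
have YT : Y *m T = S *m Y' by rewrite /T !mulmxA (halfYX pA) mul1mx.
have TX : T *m X' = X *m S by rewrite /T -mulmxA (halfYX pA') mulmx1.
have TY : T^t* *m Y = Y' *m S^t*.
  by rewrite hT -(mulmxA _ X Y) (halfXY pA) mulmx1.
have XT : X' *m T^t* = S^t* *m X.
  by rewrite hT !mulmxA (halfXY pA') mul1mx.
rewrite gm.unlock -/X -/Y -/A' -/X' -/Y'; clearbody T.
have -> : Y' *m (S^t* *m B *m S) *m Y' = T^t* *m (Y *m B *m Y) *m T.
  by rewrite !mulmxA TY -(mulmxA _ Y T) YT !mulmxA.
rewrite (mpow_unitary _ (pd_herm (pd_halfY pA pB)) uT).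
by rewrite !mulmxA XT -(mulmxA _ T X') TX !mulmxA.
Qed.

Lemma mpow_1 n s : mpow (1%:M : 'M[C]_n) s = 1%:M.
Proof.
have u : (1%:M : 'M[C]_n) \is unitarymx by apply/unitarymxP; rewrite adj1 mulmx1.
rewrite -(sp_const 1 u) (mpow_sp _ _ u); congr (sp _ _).
by apply/funext=> i; rewrite powR1.
Qed.

Lemma gm1l n a (B : 'M[C]_n) : gm a 1%:M B = mpow B a.
Proof. by rewrite gm.unlock !mpow_1 !mul1mx !mulmx1. Qed.

Lemma gmZ n a x y (A B : 'M[C]_n) : 0 < x -> 0 < y -> pdmx A -> pdmx B ->
  gm a (x%:C *: A) (y%:C *: B) = (x `^ (1 - a) * y `^ a)%:C *: gm a A B.
Proof.
move=> x0 y0 pA pB; rewrite gm.unlock !(mpow_scale _ (ltW x0) pA.1).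
have e : x `^ (- (1 / 2)) * x `^ (- (1 / 2)) = x^-1.
  rewrite -powRD ?(gt_eqF x0) ?implybT // -opprD -splitr.
  by rewrite powR_inv1 // ltW.
rewrite -!scalemxAl -!scalemxAr -!scalemxAl !scalerA -!rmorphM /=.
have -> : x `^ (- (1 / 2)) * (x `^ (- (1 / 2)) * y) = y / x.
  by rewrite mulrA e mulrC.
rewrite (mpow_scale a (divr_ge0 (ltW y0) (ltW x0)) (pd_halfY pA pB).1).
rewrite -scalemxAr -scalemxAl scalerA -rmorphM /=.
congr (_%:C *: _); rewrite powRM ?invr_ge0 ?ltW //.
have -> : x^-1 `^ a = x `^ (- a).
  by rewrite -(powR_inv1 (ltW x0)) -powRrM mulN1r.
have -> : 1 - a = 1 / 2 + 1 / 2 + - a by field.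
rewrite !powRD ?(gt_eqF x0) ?implybT //; ring.
Qed.

Lemma gm_mpow n a (D : 'M[C]_n) s t : pdmx D ->
  gm a (mpow D s) (mpow D t) = mpow D (s * (1 - a) + t * a).
Proof.
move=> pD; have hD := pd_herm pD.
rewrite gm.unlock !(mpowM _ _ hD) !(mpowD _ _ pD) (mpowM _ _ hD) !(mpowD _ _ pD).
by congr (mpow _ _); field.
Qed.

Lemma mulmx_mpow n (M : 'M[C]_n) s : pdmx M ->
  M *m mpow M s *m M = mpow M (1 + s + 1).
Proof. by move=> pM; rewrite -!(mpowD _ _ pM) (mpow1 pM.1). Qed.

Lemma mulmx_mpowN1 n (M : 'M[C]_n) : pdmx M -> M *m mpow M (-1) = 1%:M.
Proof. by move=> pM; have := mpowVK 1 pM; rewrite (mpow1 pM.1). Qed.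

Lemma mpow_inv_uniq n (M N : 'M[C]_n) : pdmx M -> M *m N = 1%:M -> mpow M (-1) = N.
Proof.
move=> pM h; rewrite -[LHS]mulmx1 -h mulmxA -[X in _ *m X *m _](mpow1 pM.1).
by rewrite (mpowKV _ pM) mul1mx.
Qed.

Lemma mpow_inv_le1 n (M : 'M[C]_n) : lemx 1%:M M -> lemx (mpow M (-1)) 1%:M.
Proof.
move=> h; have := pd_lemx (pd1 n) h => /pd_spP[U [hU [d [d0 e]]]].
move: h; rewrite e (mpow_sp _ _ hU) -(sp_const 1 hU) lemx.unlock !spB.
move=> /(psd_sp _ hU) h; apply/(psd_sp _ hU) => i.
have := h i; rewrite subr_ge0 => d1; rewrite (powR_inv1 (ltW (d0 i))) subr_ge0.
by rewrite invf_le1 ?d0.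
Qed.

(* With D = A^(-1/2) B A^(-1/2) and e = 2 - r, the hypothesis reads D^(-a) <= A,
   and A^r #_a B^r = A^(1/2) (A^(1-e) #_a D (A #_e D^(-1)) D) A^(1/2).  Replacing
   A by D^(-a) twice inside the parentheses collapses them to D^a. *)
Lemma ando_hiai_core n a r (A B : 'M[C]_n) : 0 <= a <= 1 -> 1 <= r <= 2 ->
  pdmx A -> pdmx B ->
  lemx 1%:M (gm a A B) -> lemx 1%:M (gm a (mpow A r) (mpow B r)).
Proof.
move=> a01 r12 pA pB h1.
(* The range [1 <= r <= 2] makes [e] and [1 - e] lie in [0, 1], as monotonicity of the weight-[e]
   mean and of the power [1 - e] requires. *)
have [e Ee] : exists e, 2 - r = e by eexists.
have e01 : 0 <= e <= 1 by rewrite -Ee; lra.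
set X := mpow A (1 / 2); set Y := mpow A (- (1 / 2)).
pose D := Y *m B *m Y; have pD : pdmx D by exact: pd_halfY.
have XX : X *m X = A := halfXX pA.
have XY : X *m Y = 1%:M := halfXY pA.
have YX : Y *m X = 1%:M := halfYX pA.
have EB : X *m D *m X = B.
  by rewrite /D !mulmxA XY mul1mx -mulmxA YX mulmx1.
have gmAB : gm a A B = X *m mpow D a *m X by rewrite gm.unlock.
have step1 : lemx (mpow D (- a)) A.
  have M1 : mpow (gm a A B) (-1) = Y *m mpow D (- a) *m Y.
    apply: mpow_inv_uniq; first exact: gm_pd.
    rewrite gmAB !mulmxA -(mulmxA _ X Y) XY mulmx1 -(mulmxA X) (mpowVK _ pD).
    by rewrite mulmx1.
  have := mpow_inv_le1 h1; rewrite M1 => /(lemx_halfX pA).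
  by rewrite mulmx1 XX !mulmxA XY mul1mx -mulmxA YX mulmx1.
have step2 : lemx (mpow D (- a * (1 - e))) (mpow A (1 - e)).
  rewrite -(mpowM _ _ (pd_herm pD)); apply: (mpow_loewner (pd_pow _ pD).1 pA step1); lra.
pose G := gm e A (mpow D (-1)).
have pD1 : pdmx (mpow D (-1)) by exact: pd_pow.
have pG : pdmx G by exact: gm_pd.
have step3 : lemx (mpow D (- a * (1 - e) - e)) G.
  have -> : - a * (1 - e) - e = - a * (1 - e) + -1 * e by ring.
  rewrite -(gm_mpow _ _ _ pD); exact: (gm_mono e01 (pd_pow _ pD) pD1 step1 (lemxx _)).
have step4 : lemx (mpow D (2 - a * (1 - e) - e)) (D *m G *m D).
  have := lemx_congr D step3; rewrite (pd_herm pD).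
  rewrite (mulmx_mpow _ pD).
  suff -> : 2 - a * (1 - e) - e = 1 + (- a * (1 - e) - e) + 1 by [].
  by ring.
have step5 : lemx (mpow D a) (gm a (mpow A (1 - e)) (D *m G *m D)).
  have ea : a = - a * (1 - e) * (1 - a) + (2 - a * (1 - e) - e) * a by ring.
  rewrite {1}ea.
  rewrite -(gm_mpow _ _ _ pD).
  exact: (gm_mono a01 (pd_pow _ pD) (pd_pow _ pD) step2 step4).
have pDGD : pdmx (D *m G *m D).
  by rewrite -{1}(pd_herm pD); apply: pd_congr => //; exact: pD.2.
have DX : D *m X = Y *m B by rewrite /D -mulmxA YX mulmx1.
have XD : X *m D = B *m Y by rewrite /D !mulmxA XY mul1mx.
(* Congruence by [Y] sends [A] to the identity and [D^(-1)] to [B^(-1)], so it sends [G] to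
   [1 #_e B^(-1)], a plain power of [B]. *)
have YGY : Y *m G *m Y = mpow B (- e).
  have := gm_congr e pA pD1 (halfY_unit pA).
  rewrite (halfY_herm pA) (halfYAY pA) gm1l -/Y -/G => <-.
  have <- : mpow B (-1) = Y *m mpow D (-1) *m Y.
    apply: (mpow_inv_uniq pB); rewrite -EB; clearbody D X Y.
    have -> : X *m D *m X *m (Y *m mpow D (-1) *m Y) =
        X *m D *m (X *m Y) *m mpow D (-1) *m Y by rewrite !mulmxA.
    by rewrite XY mulmx1 -(mulmxA X) (mulmx_mpowN1 pD) mulmx1 XY.
  by rewrite (mpowM _ _ (pd_herm pB)) mulN1r.
(* Congruence by [X] raises [A^(1-e)] to [A^(2-e) = A^r], and turns [D G D] into
   [B (Y G Y) B = B^(2-e) = B^r]. *)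
have eq : gm a (mpow A r) (mpow B r) =
    X *m gm a (mpow A (1 - e)) (D *m G *m D) *m X.
  have := gm_congr a (pd_pow (1 - e) pA) pDGD (halfX_unit pA).
  rewrite (halfX_herm pA) !(mpowD _ _ pA) -/X => <-.
  have -> : 1 / 2 + (1 - e) + 1 / 2 = r by rewrite -Ee; field.
  congr (gm a _ _); clearbody D G.
  have -> : X *m (D *m G *m D) *m X = X *m D *m G *m (D *m X).
    by rewrite !mulmxA.
  rewrite XD DX; clearbody Y.
  have -> : B *m Y *m G *m (Y *m B) = B *m (Y *m G *m Y) *m B.
    by rewrite !mulmxA.
  rewrite YGY (mulmx_mpow _ pB).
  have -> : 1 + - e + 1 = r by rewrite -Ee; ring.
  by [].
rewrite eq; apply: (lemx_trans h1); rewrite gmAB.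
exact: (lemx_halfX pA step5).
Qed.

(** A large exponent is halved until it falls into [1, 2]; each halving is undone by the core case
    with exponent 2. *)
Theorem ando_hiai n a r (A B : 'M[C]_n) : 0 <= a <= 1 -> 1 <= r ->
  pdmx A -> pdmx B ->
  lemx 1%:M (gm a A B) -> lemx 1%:M (gm a (mpow A r) (mpow B r)).
Proof.
move=> a01 r1 pA pB h1.
suff H k : forall s, 1 <= s -> s <= 2 ^+ k ->
    lemx 1%:M (gm a (mpow A s) (mpow B s)).
  apply: (H (Num.bound r)) => //; have r0 : 0 <= r by lra.
  apply: ltW; apply: (lt_le_trans (archi_boundP r0)).
  by rewrite -natrX ler_nat ltnW // ltn_expl.
elim: k => [|k IH] s s1 sk.
  apply: ando_hiai_core => //; apply/andP; split=> //.
  by apply: (le_trans sk); rewrite expr0; lra.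
have [s2|s2] := leP s 2; first by apply: ando_hiai_core => //; rewrite s1.
have -> : s = s / 2 * 2 by field.
rewrite -(mpowM _ _ (pd_herm pA)) -(mpowM _ _ (pd_herm pB)).
apply: (ando_hiai_core a01 _ (pd_pow _ pA) (pd_pow _ pB)); first by lra.
by apply: IH; [lra|rewrite ler_pdivrMr // -exprSr].
Qed.

End GeometricMean.

(** * The Cauchy-Binet formula and compound matrices *)

(** The [k]-element subsets of the index set; listing each in increasing order fixes the signs of
    the minors. *)
Definition incr_tuple (k l : nat) :=
  {t : k.-tuple 'I_l | sorted ltn (map val t)}.

Section CauchyBinet.
Variables (F : comNzRingType) (k l : nat).

Definition tupf (t : k.-tuple 'I_l) (i : 'I_k) : 'I_l := tnth t i.

Lemma incr_lt (t : incr_tuple k l) (i j : 'I_k) :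
  (i < j)%N -> (tupf (val t) i < tupf (val t) j)%N.
Proof.
case: t => t /= st ij; have x0 := tnth t i.
have := sorted_ltn_nth ltn_trans 0%N st => /(_ i j).
rewrite !inE !size_map size_tuple => /(_ (ltn_ord i) (ltn_ord j) ij).
by rewrite !(nth_map x0) ?size_tuple // /tupf !(tnth_nth x0).
Qed.

Lemma incr_inj (t : incr_tuple k l) : injective (tupf (val t)).
Proof.
move=> i j e; apply: val_inj; case: (ltngtP i j) => // h.
  by have := incr_lt t h; rewrite e ltnn.
by have := incr_lt t h; rewrite e ltnn.
Qed.

Lemma incr_eq (t u : incr_tuple k l) : val t =i val u -> t = u.
Proof.
move=> e; apply/val_inj/val_inj/(inj_map val_inj).
apply: (irr_sorted_eq ltn_trans ltnn); [exact: (valP t)|exact: (valP u)|].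
by apply: eq_mem_map.
Qed.

Definition tup_perm (p : incr_tuple k l * 'S_k) : {ffun 'I_k -> 'I_l} :=
  [ffun i => tupf (val p.1) (p.2 i)].

Lemma tup_perm_injb p : injectiveb (tup_perm p).
Proof.
by apply/injectiveP => i j; rewrite !ffunE => /incr_inj/perm_inj.
Qed.

Lemma tup_perm_inj : injective tup_perm.
Proof.
move=> [t s] [u s'] e.
have mem (v : incr_tuple k l) r x : (x \in codom (tup_perm (v, r))) = (x \in val v).
  apply/codomP/tnthP => -[i ->]; first by exists (r i); rewrite ffunE.
  by exists (r^-1%g i); rewrite ffunE /= permKV.
have tu : t = u by apply: incr_eq => x; rewrite -(mem t s) e mem.
rewrite tu in e *; congr (_, _); apply/permP => i.
by move/ffunP/(_ i): e; rewrite !ffunE => /incr_inj.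
Qed.

(** Sorting the values of [f] produces the tuple, and the sorting permutation is the second
    component. *)
Lemma tup_perm_surj (f : {ffun 'I_k -> 'I_l}) : injectiveb f ->
  exists p, tup_perm p = f.
Proof.
move=> /injectiveP fi; pose leo (a b : 'I_l) := (a <= b)%N.
pose c := [tuple f i | i < k].
have uc : uniq c by rewrite /= map_inj_uniq ?enum_uniq.
have st : sorted ltn (map val (sort_tuple leo c)).
  rewrite ltn_sorted_uniq_leq map_inj_uniq ?sort_uniq; last exact: val_inj.
  rewrite uc sorted_map; apply: sort_sorted => a b; exact: leq_total.
have /tuple_permP[s es] : perm_eq c (sort_tuple leo c).
  by rewrite perm_sym perm_sort.
exists (exist _ (sort_tuple leo c) st, s); apply/ffunP => i; rewrite ffunE /=.
have {}es : c = [tuple tnth (sort_tuple leo c) (s i0)  | i0 < k] by exact: val_inj.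
by have := congr1 (fun x => tnth x i) es; rewrite !tnth_mktuple => ->.
Qed.

(* Expanding the determinant leaves a sum over injective maps, each of which is
   uniquely an increasing tuple composed with a permutation. *)
Lemma cauchy_binet (A : 'M[F]_(k, l)) (B : 'M[F]_(l, k)) :
  \det (A *m B) = \sum_(t : incr_tuple k l)
    \det (colsub (tupf (val t)) A) * \det (rowsub (tupf (val t)) B).
Proof.
pose Q (f : {ffun 'I_k -> 'I_l}) := \prod_i A i (f i) * \det (rowsub f B).
have -> : \det (A *m B) = \sum_f Q f.
  transitivity (\sum_(f : {ffun 'I_k -> 'I_l}) \sum_(s : 'S_k)
      (-1) ^+ s * \prod_i (A i (f i) * B (f i) (s i))).
    rewrite exchange_big; apply: eq_bigr => /= s _; rewrite -big_distrr /=.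
    congr (_ * _); rewrite -(bigA_distr_bigA (fun i j => A i j * B j (s i))) /=.
    by apply: eq_bigr => x _; rewrite mxE.
  apply: eq_bigr => f _; rewrite /Q big_distrr /=; apply: eq_bigr => s _.
  rewrite big_split /= mulrCA; congr (_ * (_ * _)).
  by apply: eq_bigr => x _; rewrite mxE.
rewrite (bigID (fun f : {ffun _} => injectiveb f)) /= addrC big1 ?add0r; last first.
  move=> f /injectivePn[i1 [i2 ne e]]; rewrite /Q.
  by rewrite (determinant_alternate ne) ?mulr0 // => j; rewrite !mxE e.
transitivity (\sum_(p : incr_tuple k l * 'S_k) Q (tup_perm p)).
  rewrite (eq_bigr (fun f => \sum_(p | tup_perm p == f) Q (tup_perm p))); last first.
    move=> f /tup_perm_surj[p <-]; rewrite (big_pred1 p) // => q.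
    by rewrite (inj_eq tup_perm_inj).
  rewrite (exchange_big_dep xpredT) //=; apply: eq_bigr => p _.
  by rewrite (big_pred1 (tup_perm p)) // => f /=; rewrite eq_sym;
     case: eqP => [->|]; rewrite ?andbF // tup_perm_injb.
rewrite -(pair_bigA _ (fun t s => Q (tup_perm (t, s)))) /=.
apply: eq_bigr => t _; rewrite big_distrl /=; apply: eq_bigr => s _.
rewrite /Q (_ : rowsub _ B = row_perm s (rowsub (tupf (val t)) B)); last first.
  by apply/matrixP => i j; rewrite !mxE ffunE.
rewrite row_permE det_mulmx det_perm mulrCA mulrA; congr (_ * _ * _).
by apply: eq_bigr => i _; rewrite !mxE ffunE.
Qed.

End CauchyBinet.

Section Compound.
Variables (F : comNzRingType) (k l : nat).

(** The matrix of the [k]-th exterior power of [A] in the standard basis; [enum_val] numbers the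
    basis because matrix indices are ordinals. *)
Definition compound (A : 'M[F]_l) : 'M[F]_#|{: incr_tuple k l}| :=
  \matrix_(p, q) \det (mxsub (tupf (val (enum_val p))) (tupf (val (enum_val q))) A).

Lemma compoundM A B : compound (A *m B) = compound A *m compound B.
Proof.
apply/matrixP => p q; rewrite !mxE mxsub_mul cauchy_binet.
rewrite (reindex (@enum_val _ {: incr_tuple k l})) /=; last exact: onW_bij (@enum_val_bij _).
apply: eq_bigr => j _; rewrite [compound A _ _]mxE [compound B _ _]mxE.
congr (_ * _); congr (determinant _); apply/matrixP => a b; by rewrite !mxE.
Qed.

Lemma det_row0 n (A : 'M[F]_n) i : (forall j, A i j = 0) -> \det A = 0.
Proof.
by move=> h; rewrite (expand_det_row A i) big1 // => j _; rewrite h mul0r.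
Qed.

Lemma compound_diag (d : 'rV[F]_l) : compound (diag_mx d) =
  diag_mx (\row_p \prod_i d 0 (tupf (val (enum_val p)) i)).
Proof.
apply/matrixP => p q; rewrite !mxE.
have [<-|npq] := eqVneq p q.
  rewrite mulr1n.
  transitivity (\det (diag_mx (\row_j d 0 (tupf (val (enum_val p)) j)))).
    congr (\det _); apply/matrixP => i j.
    by rewrite !mxE (inj_eq (@incr_inj _ _ _)).
  by rewrite det_diag; apply: eq_bigr => i _; rewrite mxE.
rewrite mulr0n.
(* Distinct increasing tuples of equal length have different entry sets, so some row index from [p]
   is absent from the columns of [q], and that row of the minor vanishes. *)
have [i hi] : exists i, tupf (val (enum_val p)) i \notin (val (enum_val q)).
  apply/existsP; apply: contraNT npq => /existsPn h.
  apply/eqP/enum_val_inj; set t := enum_val p in h *; set u := enum_val q in h *.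
  have tu : {subset val t <= val u}.
    by move=> x /tnthP[i ->]; have := h i; rewrite negbK.
  have ut (v : incr_tuple k l) : uniq (val v).
    by rewrite -(map_inj_uniq val_inj) (sorted_uniq ltn_trans ltnn) //; exact: (valP v).
  apply: incr_eq; have [] := uniq_min_size (ut t) tu; last by [].
  by rewrite !size_tuple.
apply: (@det_row0 _ _ i) => j; rewrite !mxE.
case: eqP => [e|_]; last by rewrite mulr0n.
by move: hi; rewrite e /tupf mem_tnth.
Qed.

Lemma compound1 : compound 1%:M = 1%:M.
Proof.
rewrite -diag_const_mx compound_diag -[RHS]diag_const_mx; congr diag_mx.
by apply/rowP => p; rewrite !mxE big1 // => i _; rewrite mxE.
Qed.

Lemma compound_tr A : compound A^T = (compound A)^T.
Proof. by apply/matrixP => p q; rewrite !mxE -det_tr trmx_mxsub trmxK. Qed.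

End Compound.

(** * Products of the smallest eigenvalues *)

HB.lock Definition lam (R : realType) n (A : 'M[R[i]]_n) (i : 'I_n) : R :=
  lambda A 0 i.

Section CompoundSpectral.
Context {R : realType}.
Local Notation C := R[i].

Section FixedOrder.
Variables (k l : nat).
Local Notation cpd := (@compound C k l).

Lemma compound_adj A : cpd (A^t*) = (cpd A)^t*.
Proof.
rewrite -(compound_tr k A); apply/matrixP => p q.
by rewrite !mxE -det_map_mx map_mxsub.
Qed.

Lemma compound_unitary U : U \is unitarymx -> cpd U \is unitarymx.
Proof.
move=> hU; apply/unitarymxP.
by rewrite -compound_adj -compoundM (unitaryK hU) compound1.
Qed.

Definition cprod (d : 'I_l -> R) (p : 'I_#|{: incr_tuple k l}|) : R :=
  \prod_i d (tupf (val (enum_val p)) i).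

Lemma compound_sp U d : cpd (sp U d) = sp (cpd U) (cprod d).
Proof.
rewrite !sp.unlock !compoundM compound_adj /dg compound_diag.
suff -> : \row_p \prod_i (\row_j (d j)%:C) 0 (tupf (val (enum_val p)) i) =
    \row_i (cprod d i)%:C :> 'rV_#|{: incr_tuple k l}| by [].
apply/rowP => p; rewrite !mxE /cprod rmorph_prod.
by apply: eq_bigr => i _; rewrite mxE.
Qed.

Lemma prod_powR (I : finType) (P : pred I) (d : I -> R) r : (forall i, 0 <= d i) ->
  \prod_(i | P i) d i `^ r = (\prod_(i | P i) d i) `^ r.
Proof.
move=> d0; suff [_ ->] : 0 <= \prod_(i | P i) d i /\
    \prod_(i | P i) d i `^ r = (\prod_(i | P i) d i) `^ r by [].
apply: (big_rec2 (fun x y => 0 <= y /\ x = y `^ r)) => [|i x y _ [y0 ->]].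
  by rewrite powR1 ler01.
by rewrite mulr_ge0 // powRM.
Qed.

Lemma compound_pd A : pdmx A -> pdmx (cpd A).
Proof.
move=> /pd_spP[U [hU [d [d0 ->]]]]; rewrite compound_sp.
by apply/(pd_sp _ (compound_unitary hU)) => p; apply: prodr_gt0.
Qed.

Lemma compound_mpow A r : psdmx A -> cpd (mpow A r) = mpow (cpd A) r.
Proof.
move=> /psd_spP[U [hU [d [d0 ->]]]]; rewrite (mpow_sp _ _ hU) !compound_sp.
rewrite (mpow_sp _ _ (compound_unitary hU)); congr (sp _ _).
by apply/funext => p; rewrite /cprod prod_powR.
Qed.

Lemma compound_gm a A B : pdmx A -> pdmx B -> cpd (gm a A B) = gm a (cpd A) (cpd B).
Proof.
move=> pA pB; rewrite !gm.unlock !compoundM.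
rewrite (compound_mpow _ (pd_halfY pA pB).1) !compoundM.
by rewrite !(compound_mpow _ pA.1).
Qed.

Lemma compound_le1 A : psdmx A -> lemx A 1%:M -> lemx (cpd A) 1%:M.
Proof.
move=> /psd_spP[U [hU [d [d0 ->]]]]; rewrite compound_sp.
have hV := compound_unitary hU.
rewrite -(sp_const 1 hU) -(sp_const 1 hV) lemx.unlock !spB => /(psd_sp _ hU) h.
apply/(psd_sp _ hV) => p; rewrite subr_ge0 /cprod.
apply: (@le_trans _ _ (\prod_(i < k) 1)); last by rewrite big1.
by apply: ler_prod => i _; rewrite d0 -subr_ge0 h.
Qed.

(** Congruence by [B^(-1/2)] reduces the claim to [K <= 1], where the eigenvalues of the compound
    are products of numbers in [0, 1]; multiplicativity carries the congruence back. *)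
Lemma compound_lemx A B : psdmx A -> pdmx B -> lemx A B -> lemx (cpd A) (cpd B).
Proof.
move=> pA pB AB; set X := mpow B (1 / 2); set Y := mpow B (- (1 / 2)).
pose K := Y *m A *m Y.
have hX : X^t* = X := halfX_herm pB.
have hY : Y^t* = Y := halfY_herm pB.
have K1 : lemx K 1%:M by rewrite -(halfYAY pB); exact: (lemx_halfY pB AB).
have pK : psdmx K by have := psd_congr Y pA; rewrite hY.
have eA : A = X *m K *m X.
  rewrite /K; have XY : X *m Y = 1%:M := halfXY pB.
  have YX : Y *m X = 1%:M := halfYX pB.
  by rewrite !mulmxA XY mul1mx -mulmxA YX mulmx1.
have eB : B = X *m 1%:M *m X by rewrite mulmx1 (halfXX pB).
have := lemx_congr (cpd X) (compound_le1 pK K1).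
rewrite -compound_adj hX -(@compound1 C k l) -!compoundM -eA -eB; exact.
Qed.

End FixedOrder.

Section Bottom.
Variables (k l : nat).
Hypothesis kl : (k <= l)%N.

Definition botprod (d : 'I_l -> R) : R := \prod_(i < l | (l - k <= i)%N) d i.

Lemma last_ord_subproof (i : 'I_k) : (l - k + i < l)%N.
Proof. by rewrite -[X in (_ < X)%N](subnK kl) ltn_add2l. Qed.
Definition last_ord i := Ordinal (last_ord_subproof i).

Lemma botprodE d : botprod d = \prod_(i < k) d (last_ord i).
Proof.
(* Extending [d] by 0 to all naturals permits shifting the summation range; the default is never
   reached. *)
pose f n : R := oapp d 0 (insub n).
have fE (i : 'I_l) : f i = d i by rewrite /f insubT //= => h; congr d; exact: val_inj.
transitivity (\prod_(i < l | (l - k <= i)%N) f i).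
  by apply: eq_bigr => i _; rewrite fE.
rewrite -(big_geq_mkord (l - k) l xpredT f) -{1}(add0n (l - k)%N) big_addn subKn //.
rewrite big_mkord; apply: eq_bigr => i _.
by rewrite addnC -[(l - k + i)%N]/(val (last_ord i)) fE.
Qed.

(** Entry [i] is followed by [k - 1 - i] strictly larger ones, all below [l]; [H] counts the
    growth. *)
Lemma incr_tuple_le (t : incr_tuple k l) (i : 'I_k) :
  (tupf (val t) i <= last_ord i)%N.
Proof.
suff H m : forall j : 'I_k, (i + m = j)%N -> (tupf (val t) i + m <= tupf (val t) j)%N.
  have k0 : (0 < k)%N by apply: leq_ltn_trans (ltn_ord i).
  have hk : (k.-1 < k)%N by rewrite prednK.
  have := H (k.-1 - i)%N (Ordinal hk).
  rewrite subnKC /=; last by rewrite -ltnS prednK.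
  move=> /(_ erefl); have := ltn_ord (tupf (val t) (Ordinal hk)).
  have := ltn_ord i; move: kl k0; move: (nat_of_ord _) (nat_of_ord _) (nat_of_ord _).
  by lia.
elim: m => [|m IH] j; first by rewrite !addn0 => e; rewrite (_ : i = j) //; exact: val_inj.
rewrite addnS => e; have hm : (i + m < k)%N by rewrite e ltnW.
rewrite addnS; apply: (leq_ltn_trans (IH (Ordinal hm) erefl)).
by apply: incr_lt; rewrite /= -e.
Qed.

Lemma last_tuple_exists : exists t : incr_tuple k l, forall i, tupf (val t) i = last_ord i.
Proof.
have st : sorted ltn (map val [tuple last_ord i | i < k]).
  rewrite -map_comp.
  rewrite (_ : map _ _ = iota (l - k) k) ?iota_ltn_sorted //.
  rewrite -[X in iota X _]addn0 iotaDl -val_enum_ord -map_comp.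
  by rewrite val_ord_tuple; apply: eq_map.
by exists (exist _ [tuple last_ord i | i < k] st) => i; rewrite /tupf tnth_mktuple.
Qed.

(** The eigenvalues of the compound are products of [d] along increasing tuples. As [d] decreases,
    [incr_tuple_le] makes the tuple of the last [k] indices give the smallest one. *)
Lemma compound_ge (U : 'M[C]_l) d c : U \is unitarymx -> (forall i, 0 <= d i) ->
  (forall i j : 'I_l, (i <= j)%N -> d j <= d i) ->
  lemx c%:C%:M (@compound C k l (sp U d)) <-> c <= botprod d.
Proof.
move=> hU d0 dm; have hV := compound_unitary k hU.
rewrite compound_sp -(sp_const c hV) lemx.unlock spB; split.
  move=> /(psd_sp _ hV) h; have [t ht] := last_tuple_exists.
  have := h (enum_rank t); rewrite subr_ge0 /cprod enum_rankK botprodE.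
  by under eq_bigr do rewrite ht.
move=> h; apply/(psd_sp _ hV) => p; rewrite subr_ge0; apply: (le_trans h).
rewrite botprodE; apply: ler_prod => i _; rewrite d0 /=; apply: dm.
exact: incr_tuple_le.
Qed.

End Bottom.

Lemma sp_entry n (U : 'M[C]_n) d a b :
  sp U d a b = \sum_i (U i a)^* * (d i)%:C * U i b.
Proof.
rewrite sp.unlock mxE; apply: eq_bigr => i _; rewrite mul_mx_diag !mxE.
by rewrite conjCE.
Qed.

Lemma sp_perm n (U : 'M[C]_n) d (s : 'S_n) :
  sp U d = sp (row_perm s U) (fun i => d (s i)).
Proof.
apply/matrixP => a b; rewrite !sp_entry (reindex_inj (@perm_inj _ s)).
by apply: eq_bigr => i _; rewrite !mxE.
Qed.

Lemma row_perm_unitary n (U : 'M[C]_n) (s : 'S_n) :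
  U \is unitarymx -> row_perm s U \is unitarymx.
Proof.
move=> hU; rewrite row_permE; apply: (mul_unitarymx _ hU).
apply/unitarymxP; rewrite tr_perm_mx.
have -> : map_mx Num.conj (perm_mx s^-1) = perm_mx s^-1 :> 'M[C]_n.
  by apply/matrixP => i j; rewrite !mxE; case: eqP => _; rewrite ?conjC1 ?conjC0.
by rewrite -perm_mxM mulgV perm_mx1.
Qed.

Lemma char_poly_sp n (U : 'M[C]_n) d : U \is unitarymx ->
  char_poly (sp U d) = \prod_i ('X - ((d i)%:C)%:P).
Proof.
move=> hU; pose P (M : 'M[C]_n) := map_mx (@polyC C) M.
have PM M N : P (M *m N) = P M *m P N by exact: map_mxM.
have e : char_poly_mx (sp U d) = P (U^t*) *m ('X%:M - P (dg d)) *m P U.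
  rewrite mulmxBr mulmxBl -!PM /char_poly_mx -/(P _) [in LHS]sp.unlock.
  suff -> : P (U^t*) *m 'X%:M *m P U = 'X%:M by [].
  by rewrite scalar_mxC -mulmxA -PM (unitaryVK hU) /P map_mx1 mulmx1.
rewrite /char_poly e !det_mulmx mulrAC -det_mulmx -PM (unitaryVK hU) /P map_mx1 det1 mul1r.
have -> : 'X%:M - map_mx (@polyC C) (dg d) = diag_mx (\row_i ('X - ((d i)%:C)%:P)).
  apply/matrixP => i j; rewrite !mxE.
  by case: eqP => _; rewrite ?mulr1n // !mulr0n subr0.
by rewrite det_diag; apply: eq_bigr => i _; rewrite mxE.
Qed.

(** Bridge from the definition by roots: the characteristic polynomial shows that sorted roots and
    diagonal entries agree up to a permutation, which is absorbed into the rows of the unitary. *)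
Lemma lambda_spectral n (A : 'M[C]_n) : A^t* = A ->
  exists U, [/\ U \is unitarymx, A = sp U (lam A) &
    forall i j : 'I_n, (i <= j)%N -> lam A j <= lam A i].
Proof.
move=> /herm_sp[U [hU [d eA]]]; rewrite lam.unlock.
set r := sval (closed_field_poly_normal (char_poly A)).
have er : perm_eq r [seq (d i)%:C | i <- enum 'I_n].
  apply: prod_XsubC_eq; rewrite big_map big_enum /= -(char_poly_sp d hU) -eA.
  have := svalP (closed_field_poly_normal (char_poly A)); rewrite -/r => er.
  by rewrite (monicP (char_poly_monic A)) scale1r in er.
set s := sort >=%R [seq complex.Re z | z <- r].
have es : perm_eq s [tuple d i | i < n].
  rewrite perm_sort; apply: (perm_trans (perm_map _ er)).
  by rewrite -map_comp.
have [p ep] := tuple_permP es.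
have szs : size s = n by rewrite ep size_tuple.
have lamE i : lambda A 0 i = d (p i).
  rewrite mxE -/r -/s ep.
  by rewrite -(tnth_nth 0) !tnth_mktuple.
exists (row_perm p U); split; first exact: row_perm_unitary.
  by rewrite {1}eA (sp_perm _ _ p); congr (sp _ _); apply/funext => i; rewrite lamE.
move=> i j ij; rewrite !mxE -/r -/s.
have ss : sorted >=%R s by apply: sort_sorted => a b; exact: le_total.
have tr : transitive (>=%R : rel R) by move=> a b c ab bc; exact: le_trans bc ab.
have rf : reflexive (>=%R : rel R) by move=> a; exact: lexx.
by apply: (sorted_leq_nth tr rf 0 ss); rewrite ?inE ?szs.
Qed.

Lemma lam_ge0 n (A : 'M[C]_n) i : psdmx A -> 0 <= lam A i.
Proof.
move=> pA; have [U [hU e _]] := lambda_spectral (psd_herm pA).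
by move: pA; rewrite {1}e => /(psd_sp _ hU).
Qed.

Lemma lam_gt0 n (A : 'M[C]_n) i : pdmx A -> 0 < lam A i.
Proof.
move=> pA; have [U [hU e _]] := lambda_spectral (pd_herm pA).
by move: pA; rewrite {1}e => /(pd_sp _ hU).
Qed.

Section BottomLambda.
Variables (k l : nat).
Hypothesis kl : (k <= l)%N.
Local Notation botl A := (botprod k (lam A)).

Lemma compound_ge_lam (A : 'M[C]_l) c : psdmx A ->
  lemx c%:C%:M (@compound C k l A) <-> c <= botl A.
Proof.
move=> pA; have [U [hU e m]] := lambda_spectral (psd_herm pA).
rewrite {1}e; apply: compound_ge => // i; exact: lam_ge0.
Qed.

Lemma botprod_ge0 (A : 'M[C]_l) : psdmx A -> 0 <= botl A.
Proof. by move=> pA; apply: prodr_ge0 => i _; exact: lam_ge0. Qed.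

Lemma botprod_gt0 (A : 'M[C]_l) : pdmx A -> 0 < botl A.
Proof. by move=> pA; apply: prodr_gt0 => i _; exact: lam_gt0. Qed.

Lemma botprod_lemx (A B : 'M[C]_l) : psdmx A -> pdmx B -> lemx A B -> botl A <= botl B.
Proof.
move=> pA pB AB; apply/(compound_ge_lam _ pB.1).
apply: (lemx_trans _ (compound_lemx k pA pB AB)).
exact/(compound_ge_lam _ pA).
Qed.

(** Both sides are the largest [c] with [c I] below the compound, so they agree by antisymmetry. *)
Lemma botprod_sp (U : 'M[C]_l) d : U \is unitarymx -> (forall i, 0 <= d i) ->
  (forall i j : 'I_l, (i <= j)%N -> d j <= d i) -> botl (sp U d) = botprod k d.
Proof.
move=> hU d0 dm; have pd := (psd_sp d hU).2 d0.
apply/le_anti/andP; split.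
  by apply/(compound_ge kl _ hU d0 dm)/(compound_ge_lam _ pd).
by apply/(compound_ge_lam _ pd)/(compound_ge kl _ hU d0 dm).
Qed.

(** Dividing both compounds by [c] divides their mean by [c], as the weights sum to 1, and makes it
    at least the identity. After [ando_hiai] the same scaling reappears as [c^(-r)] and is moved to
    the other side. *)
Lemma botprod_ando_hiai a r (A B : 'M[C]_l) : 0 <= a <= 1 -> 1 <= r ->
  pdmx A -> pdmx B ->
  botl (gm a A B) `^ r <= botl (gm a (mpow A r) (mpow B r)).
Proof.
move=> a01 r1 pA pB; set c := botl (gm a A B).
have pG := gm_pd a pA pB; have c0 : 0 < c := botprod_gt0 pG.
have pG' := gm_pd a (pd_pow r pA) (pd_pow r pB).
have cV0 : 0 < c^-1 by rewrite invr_gt0.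
have cr0 : 0 < c `^ r by exact: powR_gt0.
have crV0 : 0 < c^-1 `^ r by exact: powR_gt0.
have crV : c^-1 `^ r * c `^ r = 1.
  by rewrite -powRM ?ltW // mulVf ?gt_eqF // powR1.
have pcA := compound_pd k pA; have pcB := compound_pd k pB.
have scal x : 0 < x -> x `^ (1 - a) * x `^ a = x.
  by move=> x0; rewrite -powRD ?subrK ?(gt_eqF x0) ?implybT // powRr1 // ltW.
have h : lemx 1%:M (gm a (c^-1%:C *: compound k A) (c^-1%:C *: compound k B)).
  rewrite (gmZ _ cV0 cV0 pcA pcB) (scal _ cV0) -(compound_gm _ _ pA pB).
  have -> : 1%:M = c^-1%:C *: c%:C%:M :> 'M[C]_#|{: incr_tuple k l}|.
    by rewrite scale_scalar_mx -rmorphM mulVf ?gt_eqF // rmorph1.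
  by apply: (lemxZ (ltW cV0)); apply/(compound_ge_lam _ pG.1).
have := ando_hiai a01 r1 (pdZ cV0 pcA) (pdZ cV0 pcB) h.
rewrite (mpow_scale _ (ltW cV0) pcA.1) (mpow_scale _ (ltW cV0) pcB.1).
rewrite -(compound_mpow k r pA.1) -(compound_mpow k r pB.1).
rewrite (gmZ _ crV0 crV0) ?(scal _ crV0); last 2 first.
- exact: (compound_pd k (pd_pow r pA)).
- exact: (compound_pd k (pd_pow r pB)).
rewrite -(compound_gm _ _ (pd_pow r pA) (pd_pow r pB)).
move=> /(lemxZ (ltW cr0)); rewrite scalerA -rmorphM [c `^ r * _]mulrC crV rmorph1 scale1r.
by rewrite -scalar_mxZ1 => /(compound_ge_lam _ pG'.1).
Qed.

End BottomLambda.
End CompoundSpectral.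

(** * Limits of monotone families of matrices *)

Section MonotoneLimit.
Context {R : realType}.
Local Notation C := R[i].

Lemma ReM (x y : C) :
  complex.Re (x * y) = complex.Re x * complex.Re y - complex.Im x * complex.Im y.
Proof. by case: x => ? ?; case: y. Qed.

Lemma Re_sum (I : finType) (F : I -> C) :
  complex.Re (\sum_i F i) = \sum_i complex.Re (F i).
Proof. by apply: (big_morph (@complex.Re R)) => // x y; exact: ReD. Qed.

Lemma bf_entries n (A : 'M[C]_n) u v :
  bf A u v = \sum_i \sum_j complex.Re ((u i 0)^* * v j 0 * A i j).
Proof.
rewrite bf.unlock -mulmxA mxE Re_sum; apply: eq_bigr => i _.
rewrite !mxE mulr_sumr Re_sum; apply: eq_bigr => j _.
by rewrite conjCE; congr complex.Re; ring.
Qed.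

Lemma bf_delta n (A : 'M[C]_n) i j (c : C) :
  bf A (delta_mx i 0) (c *: delta_mx j 0) = complex.Re (c * A i j).
Proof.
rewrite bf_entries (bigD1 i) //= [X in _ + X]big1 ?addr0; last first.
  move=> k ki; rewrite big1 // => m _.
  by rewrite !mxE (negbTE ki) mulr0n conjC0 !mul0r.
rewrite (bigD1 j) //= [X in _ + X]big1 ?addr0; last first.
  by move=> k kj; rewrite !mxE (negbTE kj) mulr0n !mulr0 mul0r.
by rewrite !mxE !eqxx mulr1n conjC1 mul1r mulr1.
Qed.

Lemma bf_polar n (A : 'M[C]_n) u v : A^t* = A ->
  bf A u v = (qf A u + qf A v - qf A (u - v)) / 2.
Proof.
move=> hA; rewrite !qfE (bfBl A u v (u - v)) (bfBr A u v u) (bfBr A u v v).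
by rewrite (bf_sym v u hA); field.
Qed.

Lemma psd_le_trace n (N : 'M[C]_n) : psdmx N ->
  lemx N (\sum_i complex.Re (N i i))%:C%:M.
Proof.
move=> /psd_spP[U [hU [d [d0 eN]]]].
have -> : \sum_i complex.Re (N i i) = \sum_i d i.
  rewrite -Re_sum -[\sum_i N i i]/(\tr N) eN sp.unlock mxtrace_mulC mulmxA.
  rewrite (unitaryK hU) mul1mx /mxtrace Re_sum; apply: eq_bigr => i _.
  by rewrite dgE eqxx.
rewrite eN -(sp_const _ hU) lemx.unlock spB; apply/(psd_sp _ hU) => i.
by rewrite subr_ge0 (bigD1 i) //= lerDl sumr_ge0.
Qed.

Lemma cvg_sum_fin (I : finType) (f : I -> R -> R) (a : I -> R) (F : set_system R) :
  Filter F -> (forall i, f i x @[x --> F] --> a i) ->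
  (\sum_i f i x) @[x --> F] --> \sum_i a i.
Proof.
move=> FF h; elim: (index_enum I) => [|i s IH].
  by rewrite big_nil; under eq_fun do rewrite big_nil; exact: cvg_cst.
rewrite big_cons; under eq_fun do rewrite big_cons.
exact: cvgD (h i) IH.
Qed.

Lemma at_right_forall (I : finType) (P : I -> R -> Prop) :
  (forall i, \forall e \near (0 : R)^'+, P i e) ->
  \forall e \near (0 : R)^'+, forall i, P i e.
Proof. by move=> h; apply: filter_forall. Qed.

Section Family.
Variables (l : nat) (X : R -> 'M[C]_l).
Hypothesis pX : forall e, 0 < e -> psdmx (X e).
Hypothesis mX : forall e e', 0 < e -> e <= e' -> lemx (X e) (X e').

(** For each vector the form decreases as [e] decreases to 0 and stays nonnegative; polarization
    then gives convergence of [bf], hence of the entries. *)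
Lemma qf_is_cvg v : cvg (qf (X e) v @[e --> 0^'+]).
Proof.
apply/cvg_ex; eexists.
apply: (@nondecreasing_at_right_cvgr _ _ 0 (BLeft 1)); first by rewrite bnd_simp.
  move=> x y; rewrite !in_itv /= => /andP[x0 _] _ xy.
  exact: (lemx_qf v (mX x0 xy)).
exists 0 => ? [x /=]; rewrite in_itv /= => /andP[x0 _] <-.
by have /psdP[_] := pX x0.
Qed.

Arguments qf_is_cvg : clear implicits.

Lemma bf_is_cvg u v : cvg (bf (X e) u v @[e --> 0^'+]).
Proof.
have [a ha] := (cvg_ex _).1 (qf_is_cvg u).
have [b hb] := (cvg_ex _).1 (qf_is_cvg v).
have [c hc] := (cvg_ex _).1 (qf_is_cvg (u - v)).
have H : (qf (X e) u + qf (X e) v - qf (X e) (u - v)) / 2 @[e --> 0^'+]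
    --> (a + b - c) / 2.
  by apply: cvgMr_tmp; exact: (cvgB (cvgD ha hb) hc).
apply/cvg_ex; exists ((a + b - c) / 2).
apply: cvg_trans H; apply: near_eq_cvg; near=> e.
rewrite /= -bf_polar //; apply: psd_herm; apply: pX.
by near: e; exact: nbhs_right_gt.
Unshelve. all: by end_near. Qed.

Arguments bf_is_cvg : clear implicits.

Let reM i j : R := lim (bf (X e) (delta_mx i 0) (delta_mx j 0) @[e --> 0^'+]).
(** The factor [- 'i] works because [Re(-i z) = Im z], so imaginary parts also become limits of the
    real form [bf]. *)
Let imM i j : R := lim (bf (X e) (delta_mx i 0) (- 'i *: delta_mx j 0) @[e --> 0^'+]).

Definition limmx : 'M[C]_l := \matrix_(i, j) (reM i j +i* imM i j).

Lemma Re_cvg i j : complex.Re (X e i j) @[e --> 0^'+] --> complex.Re (limmx i j).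
Proof.
rewrite mxE /=.
have -> : (fun e => complex.Re (X e i j)) =
    (fun e => bf (X e) (delta_mx i 0) (delta_mx j 0)).
  by apply/funext => e; rewrite -[delta_mx j 0]scale1r bf_delta mul1r.
exact: bf_is_cvg.
Qed.

Arguments Re_cvg : clear implicits.

Lemma Im_cvg i j : complex.Im (X e i j) @[e --> 0^'+] --> complex.Im (limmx i j).
Proof.
rewrite mxE /=.
have -> : (fun e => complex.Im (X e i j)) =
    (fun e => bf (X e) (delta_mx i 0) (- 'i *: delta_mx j 0)).
  apply/funext => e; rewrite bf_delta ReM /=.
  by rewrite oppr0 mul0r sub0r mulN1r opprK.
exact: bf_is_cvg.
Qed.

Arguments Im_cvg : clear implicits.

Lemma qf_cvg v : qf (X e) v @[e --> 0^'+] --> qf limmx v.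
Proof.
rewrite qfE bf_entries.
under eq_fun do rewrite qfE bf_entries.
apply: cvg_sum_fin => i; apply: cvg_sum_fin => j.
rewrite ReM; under eq_fun do rewrite ReM.
by apply: cvgB; apply: cvgMl_tmp; [exact: Re_cvg|exact: Im_cvg].
Qed.

Arguments qf_cvg : clear implicits.

Lemma limmx_herm : limmx^t* = limmx.
Proof.
apply/matrixP => i j; rewrite 2![in LHS]mxE conjCE.
have eR : complex.Re (limmx j i) = complex.Re (limmx i j).
  apply: (cvg_unique _ (Re_cvg j i)); first exact: Rhausdorff.
  apply: cvg_trans (Re_cvg i j); apply: near_eq_cvg; near=> e.
  have /psdP[/matrixP/(_ i j)] : psdmx (X e).
    by apply: pX; near: e; exact: nbhs_right_gt.
  by rewrite 2!mxE conjCE => <-; case: (X e j i).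
have eI : complex.Im (limmx j i) = - complex.Im (limmx i j).
  apply: (cvg_unique _ (Im_cvg j i)); first exact: Rhausdorff.
  apply: cvg_trans (cvgN (Im_cvg i j)); apply: near_eq_cvg; near=> e.
  have /psdP[/matrixP/(_ i j)] : psdmx (X e).
    by apply: pX; near: e; exact: nbhs_right_gt.
  rewrite 2!mxE conjCE => h _; rewrite -[LHS]/(- complex.Im (X e i j)) -h.
  by case: (X e j i) => x y /=; rewrite opprK.
by move: eR eI; case: (limmx j i) => a b; case: (limmx i j) => c d /= -> ->; rewrite opprK.
Unshelve. all: by end_near. Qed.

Lemma limmx_psd : psdmx limmx.
Proof.
apply/psdP; split=> [|v]; first exact: limmx_herm.
apply: (cvgr_to_ge (qf_cvg v)); near=> e.
have : psdmx (X e) by apply: pX; near: e; exact: nbhs_right_gt.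
by case/psdP.
Unshelve. all: by end_near. Qed.

Lemma limmx_le e : 0 < e -> lemx limmx (X e).
Proof.
move=> e0; apply: lemxP => [||v]; [exact: limmx_herm|exact: psd_herm (pX e0)|].
apply: (cvgr_to_le (qf_cvg v)); near=> x.
apply: lemx_qf; apply: mX; first by near: x; exact: nbhs_right_gt.
by near: x; exact: nbhs_right_le.
Unshelve. all: by end_near. Qed.

(** Turns entrywise convergence into an order bound: [X e - limmx] is positive semidefinite, hence
    at most its trace times the identity. Dividing [h] by [l + 1] also covers [l = 0]. *)
Lemma limmx_approx (h : R) : 0 < h ->
  exists2 e, 0 < e & lemx (X e) (limmx + h%:C%:M).
Proof.
move=> h0; have hl : 0 < h / l.+1%:R by rewrite divr_gt0 ?ltr0n.
have : \forall e \near 0^'+, 0 < e /\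
    forall i, complex.Re (X e i i) < complex.Re (limmx i i) + h / l.+1%:R.
  apply: filterI; first exact: nbhs_right_gt.
  apply: (at_right_forall (P := fun i e =>
    complex.Re (X e i i) < complex.Re (limmx i i) + h / l.+1%:R)) => i.
  by apply: (cvgr_lt _ (Re_cvg i i)); rewrite ltrDl.
move=> /filter_ex[e [e0 he]]; exists e => //.
have := limmx_le e0; rewrite {1}lemx.unlock => /psd_le_trace.
set t := \sum_i _ => ht.
have tl : t <= h.
  apply: (@le_trans _ _ (\sum_(i < l) h / l.+1%:R)).
    apply: ler_sum => i _; rewrite [(X e - limmx) i i]mxE [(- limmx) i i]mxE.
    by rewrite ReD ReN lerBlDl; exact: ltW (he i).
  rewrite sumr_const card_ord -[_ *+ l]mulr_natr mulrAC ler_pdivrMr ?ltr0n //.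
  by rewrite ler_pM2l // ler_nat.
have := lemx_trans ht (lemx_scalar l tl) => /(lemxD (lemxx limmx)).
by rewrite addrC subrK.
Qed.

Lemma limmx_cvg : (X e : 'M[C^o]_l) @[e --> (0 : R)^'+] --> (limmx : 'M[C^o]_l).
Proof.
move=> P [Q hQ QP]; apply: (@filterS _ _ _ [set e | forall i j, Q i j (X e i j)]).
  by move=> e h; exact: QP.
apply: (at_right_forall (P := fun i e => forall j, Q i j (X e i j))) => i.
apply: (at_right_forall (P := fun j e => Q i j (X e i j))) => j.
suff : (X e i j : C^o) @[e --> (0 : R)^'+] --> (limmx i j : C^o) by move/(_ _ (hQ i j)).
apply/cvgrPdist_lt => eps eps0.
(* Norms on [R[i]] take values in [R[i]], so the radius is a complex number; being positive, it is
   real. *)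
have [r er] : exists r : R, eps = r%:C.
  by exists (complex.Re eps); rewrite RRe_real // gtr0_real.
rewrite er ltcR in eps0 *.
near=> e.
have hR : `|complex.Re (limmx i j) - complex.Re (X e i j)| < r / 2.
  by near: e; move/cvgrPdist_lt: (Re_cvg i j); apply; rewrite divr_gt0.
have hI : `|complex.Im (limmx i j) - complex.Im (X e i j)| < r / 2.
  by near: e; move/cvgrPdist_lt: (Im_cvg i j); apply; rewrite divr_gt0.
rewrite normc_def ltcR.
move: hR hI; case: (limmx i j) => a b; case: (X e i j) => c d /= hR hI.
rewrite -(ger0_norm (ltW eps0)) -sqrtr_sqr ltr_sqrt ?exprn_gt0 //.
rewrite -[(a - c) ^+ 2]real_normK ?num_real // -[(b - d) ^+ 2]real_normK ?num_real //.
have := normr_ge0 (a - c); have := normr_ge0 (b - d); nra.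
Unshelve. all: by end_near. Qed.

End Family.

Arguments limmx_cvg : clear implicits.

(** The interface through which singular means are used later: positivity, domination by every
    regularized mean, and approximation from above within any [h I]. *)
Lemma geomean_limit l a (A B : 'M[C]_l) : 0 <= a <= 1 -> psdmx A -> psdmx B ->
  [/\ psdmx (geomean a A B),
      forall e : R, 0 < e -> lemx (geomean a A B) (gm a (A + e%:C%:M) (B + e%:C%:M)) &
      forall h : R, 0 < h -> exists2 e : R, 0 < e &
        lemx (gm a (A + e%:C%:M) (B + e%:C%:M)) (geomean a A B + h%:C%:M)].
Proof.
move=> a01 pA pB; pose X (e : R) := gm a (A + e%:C%:M) (B + e%:C%:M).
have pde (M : 'M[C]_l) (e : R) : psdmx M -> 0 < e -> pdmx (M + e%:C%:M).
  by move=> pM e0; exact: (psd_pdD pM (pd_scalar _ e0)).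
have pX e : 0 < e -> psdmx (X e).
  by move=> e0; case: (gm_pd a (pde _ _ pA e0) (pde _ _ pB e0)).
have mX e e' : 0 < e -> e <= e' -> lemx (X e) (X e').
  move=> e0 ee; apply: (gm_mono a01 (pde _ _ pA e0) (pde _ _ pB e0)).
    exact: (lemxD (lemxx A) (lemx_scalar l ee)).
  exact: (lemxD (lemxx B) (lemx_scalar l ee)).
have -> : geomean a A B = limmx X.
  have eX : (fun e : R => geomean_pd a (A + e%:C%:M) (B + e%:C%:M)) = X.
    by apply/funext => e; rewrite gmE.
  rewrite /geomean eX.
  exact: (@cvg_lim 'M[C^o]_l (@norm_hausdorff _ _) R 0^'+ _ X (limmx X)
    (limmx_cvg l X pX mX)).
split; [exact: limmx_psd|exact: limmx_le|exact: limmx_approx].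
Qed.

End MonotoneLimit.

(** * The supermajorization *)

Section PositiveMaps.
Context {R : realType}.
Local Notation C := R[i].

Lemma euclnormE n (v : 'cV[C]_n) : euclnorm v = Num.sqrt (qf 1%:M v).
Proof. by rewrite /euclnorm qf1E. Qed.

(** [sup] is informative only for a bounded set; the bound comes from [||M v||^2] being the form of
    the adjoint of [M] times [M]. *)
Lemma opnorm_ubound n (M : 'M[C]_n) : psdmx M ->
  has_ubound [set euclnorm (M *m v) | v in [set v | euclnorm v <= 1]].
Proof.
move=> pM; have hM := psd_herm pM.
have [m m0 hm] := psd_le_scalar (herm_congr M (adj1 n)).
exists (Num.sqrt m) => _ [v /= hv <-].
rewrite euclnormE ler_wsqrtr // -qf_congr.
apply: (le_trans (lemx_qf v hm)); rewrite qf_scalar; apply: (ler_piMr (ltW m0)).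
have : euclnorm v ^+ 2 <= 1 by rewrite expr_le1 // sqrtr_ge0.
by rewrite euclnormE sqr_sqrtr // qf1_ge0.
Qed.

Lemma opnorm_ge0 n (M : 'M[C]_n) : psdmx M -> 0 <= opnorm M.
Proof.
move=> pM; apply: (ub_le_sup (opnorm_ubound pM)); exists 0.
  by rewrite /= euclnormE qf_vec0 sqrtr0.
by rewrite mulmx0 euclnormE qf_vec0 sqrtr0.
Qed.

(** A unit eigenvector for [d i] shows that [d i] belongs to the set whose supremum is
    [opnorm M]. *)
Lemma psd_le_opnorm n (M : 'M[C]_n) : psdmx M -> lemx M (opnorm M)%:C%:M.
Proof.
move=> pM; have ub := opnorm_ubound pM.
have [U [hU [d [d0 eM]]]] := psd_spP pM.
have h i : d i <= opnorm M.
  apply: (ub_le_sup ub); exists (col i (U^t*)).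
    by rewrite /= euclnormE qf1_col // sqrtr1.
  rewrite eM sp_eigen // euclnormE qfE bfZl bfZr -qfE qf1_col // mulr1.
  by rewrite -expr2 sqrtr_sqr ger0_norm.
rewrite {1}eM -(sp_const _ hU) lemx.unlock spB; apply/(psd_sp _ hU) => i.
by rewrite subr_ge0.
Qed.

(** [pos_jensen] at exponent [1/r], for the matrix [A^r] and the normalized map [x^(-1) Phi]; the
    shift by [e] supplies the positive definite upper bound it asks for. *)
Lemma pos_jensen_root n l (Phi : {linear 'M[C]_n -> 'M[C]_l}) (x r e : R) A :
  positive_map Phi -> 0 < x -> 1 <= r -> 0 < e -> psdmx A ->
  lemx (Phi 1%:M) x%:C%:M ->
  lemx (Phi A) ((x * x^-1 `^ r^-1)%:C *: mpow (Phi (mpow A r) + e%:C%:M) r^-1).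
Proof.
move=> hPhi x0 r1 e0 pA h1; have r0 : 0 < r by lra.
have xV0 : 0 < x^-1 by rewrite invr_gt0.
(* Congruence by the scalar [x^(-1/2)] is multiplication by [x^(-1)], already available as a linear
   map. *)
pose S : 'M[C]_l := (Num.sqrt x^-1)%:C%:M.
have SE (M : 'M[C]_l) : congr_map S M = x^-1%:C *: M.
  rewrite congr_mapE /S adj_scalar mul_scalar_mx mul_mx_scalar scalerA -rmorphM.
  by rewrite -expr2 sqr_sqrtr // ltW.
pose Phi' : {linear 'M[C]_n -> 'M[C]_l} := congr_map S \o Phi.
have Phi'E M : Phi' M = x^-1%:C *: Phi M by exact: SE.
have hPhi' : positive_map Phi'.
  by move=> M pM; rewrite Phi'E; exact: (psdZ (ltW xV0) (hPhi _ pM)).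
have pAr : psdmx (mpow A r) by apply: mpow_psd; exact: psd_herm.
pose W := Phi (mpow A r) + e%:C%:M.
have pW : pdmx W by exact: (psd_pdD (hPhi _ pAr) (pd_scalar _ e0)).
have h1' : lemx (Phi' 1%:M) 1%:M.
  rewrite Phi'E; have := lemxZ (ltW xV0) h1.
  by rewrite scale_scalar_mx -rmorphM mulVf ?gt_eqF // rmorph1.
have hA' : lemx (Phi' (mpow A r)) (x^-1%:C *: W).
  rewrite Phi'E; apply: (lemxZ (ltW xV0)).
  have := lemxD (lemxx (Phi (mpow A r))) ((lemx0 _).2 (pd_scalar l e0).1).
  by rewrite addr0.
have s01 : 0 <= r^-1 <= 1 by rewrite invr_ge0 ltW //= invf_le1.
have := pos_jensen hPhi' pAr (pdZ xV0 pW) h1' hA' s01.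
rewrite (mpow_psdK _ pA) ?gt_eqF // Phi'E (mpow_scale _ (ltW xV0) pW.1).
move=> /(lemxZ (ltW x0)); rewrite !scalerA -!rmorphM mulfV ?gt_eqF //.
by rewrite rmorph1 scale1r.
Qed.

Lemma geomean_le_gm l a (A B W V : 'M[C]_l) : 0 <= a <= 1 ->
  psdmx A -> psdmx B -> pdmx W -> pdmx V -> lemx A W -> lemx B V ->
  lemx (geomean a A B) (gm a W V).
Proof.
move=> a01 pA pB pW pV AW BV.
have [pG hG _] := geomean_limit a01 pA pB.
have [m m0 hm] := pd_ge_scalar pW; have [m' m0' hm'] := pd_ge_scalar pV.
apply: (lemx_lim (psd_herm pG) (gm_pd a pW pV).1) => h h0.
have h1 : 0 < 1 + h by lra.
(* From [W >= m I] and [V >= m' I] follow [e I <= h W] and [e I <= h V]. Hence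
   [A + e I <= (1 + h) W], similarly for [B], and [1 + h] leaves the mean by homogeneity. *)
pose e := h * Num.min m m'.
have e0 : 0 < e by rewrite mulr_gt0 // lt_min m0.
have step (M N : 'M[C]_l) (c : R) : lemx M N -> lemx c%:C%:M N -> Num.min m m' <= c ->
    lemx (M + e%:C%:M) ((1 + h)%:C *: N).
  move=> MN cN mc; rewrite rmorphD scalerDl scale1r; apply: (lemxD MN).
  apply: (lemx_trans _ (lemxZ (ltW h0) cN)).
  by rewrite scale_scalar_mx -rmorphM; apply: lemx_scalar; rewrite ler_pM2l.
apply: (lemx_trans (hG e e0)).
have -> : (1 + h)%:C *: gm a W V = gm a ((1 + h)%:C *: W) ((1 + h)%:C *: V).
  rewrite (gmZ _ h1 h1 pW pV) -powRD ?subrK ?(gt_eqF h1) ?implybT //.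
  by rewrite powRr1 // ltW.
apply: (gm_mono a01).
- exact: (psd_pdD pA (pd_scalar _ e0)).
- exact: (psd_pdD pB (pd_scalar _ e0)).
- by apply: (step _ _ m) => //; rewrite ge_min lexx.
- by apply: (step _ _ m') => //; rewrite ge_min lexx orbT.
Qed.

(** The base 0 arises from a vanishing norm; for [p = 0] the convention [0^0 = 1] makes the function
    constant. *)
Lemma powR_cvg_right (x p : R) : 0 <= x -> 0 <= p ->
  (x + h) `^ p @[h --> (0 : R)^'+] --> x `^ p.
Proof.
move=> x0 p0; have [->|p1] := eqVneq p 0.
  by under eq_fun do rewrite powRr0; rewrite powRr0; exact: cvg_cst.
have [->|x1] := eqVneq x 0.
  under eq_fun do rewrite add0r; rewrite powR0 //; apply: powR_cvg0.
  by rewrite lt_def p1.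
have xp : 0 < x by rewrite lt_def x1.
have : {for x, continuous (fun y : R => y `^ p)}.
  apply: differentiable_continuous; apply/derivable1_diffP.
  by apply: derivable_powR; rewrite in_itv /= xp.
move=> cx; apply: (@cvg_comp _ _ _ (fun h : R => x + h) (fun y => y `^ p) _ (nbhs x)) => //.
apply: cvg_at_right_filter; rewrite -{2}(addr0 x).
by apply: cvgD; [exact: cvg_cst|exact: cvg_id].
Qed.

Lemma cvg_prod_fin (I : finType) (P : pred I) (f : I -> R -> R) (a : I -> R)
    (F : set_system R) :
  Filter F -> (forall i, f i x @[x --> F] --> a i) ->
  (\prod_(i | P i) f i x) @[x --> F] --> \prod_(i | P i) a i.
Proof.
move=> FF h; elim: (index_enum I) => [|i s IH].
  by rewrite big_nil; under eq_fun do rewrite big_nil; exact: cvg_cst.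
rewrite big_cons; under eq_fun do rewrite big_cons.
by case: ifP => _ //; exact: cvgM (h i) IH.
Qed.

Section Supermajorization.
Variables (n m l : nat).
Variables (Phi : {linear 'M[C]_n -> 'M[C]_l}) (Psi : {linear 'M[C]_m -> 'M[C]_l}).
Hypotheses (hPhi : positive_map Phi) (hPsi : positive_map Psi).
Variables (a : R) (A : 'M[C]_n) (B : 'M[C]_m) (r : R) (k : nat).
Hypotheses (a01 : 0 <= a <= 1) (pA : psdmx A) (pB : psdmx B) (r1 : 1 <= r).
Hypothesis kl : (k <= l)%N.

Let X := geomean a (Phi (mpow A r)) (Psi (mpow B r)).
Let Z := geomean a (Phi A) (Psi B).

(** The inequality with strictly positive bounds [x], [y] for the norms and with [X + h I] in place
    of [X]. The matrices [W] and [V] are chosen so that their [r]-th powers are [x^(r-1) Pe] and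
    [y^(r-1) Qe]. *)
Lemma botprod_le_regularized (x y h : R) : 0 < x -> 0 < y -> 0 < h ->
  lemx (Phi 1%:M) x%:C%:M -> lemx (Psi 1%:M) y%:C%:M ->
  botprod k (lam Z) `^ r <=
  \prod_(i < l | (l - k <= i)%N)
    ((x `^ ((1 - a) * (r - 1)) * y `^ (a * (r - 1))) * (lam X i + h)).
Proof.
move=> x0 y0 h0 hx hy; have r0 : 0 < r := lt_le_trans ltr01 r1.
have pP : psdmx (Phi (mpow A r)) by apply: hPhi; apply: mpow_psd; exact: psd_herm.
have pQ : psdmx (Psi (mpow B r)) by apply: hPsi; apply: mpow_psd; exact: psd_herm.
have [pX _ hX] := geomean_limit a01 pP pQ; rewrite -/X in pX hX.
have [pZ _ _] := geomean_limit a01 (hPhi pA) (hPsi pB); rewrite -/Z in pZ.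
have [e e0 he] := hX h h0.
have pPe : pdmx (Phi (mpow A r) + e%:C%:M) by exact: (psd_pdD pP (pd_scalar _ e0)).
have pQe : pdmx (Psi (mpow B r) + e%:C%:M) by exact: (psd_pdD pQ (pd_scalar _ e0)).
set Pe := Phi (mpow A r) + e%:C%:M in pPe he.
set Qe := Psi (mpow B r) + e%:C%:M in pQe he.
have root (z : R) : 0 < z -> 0 < z * z^-1 `^ r^-1.
  by move=> z0; rewrite mulr_gt0 // powR_gt0 // invr_gt0.
have rootr (z : R) : 0 < z -> (z * z^-1 `^ r^-1) `^ r = z `^ (r - 1).
  move=> z0; rewrite powRM ?powR_ge0 ?ltW // -powRrM mulVf ?gt_eqF //.
  rewrite powRr1 ?invr_ge0 ?ltW // powRD ?(gt_eqF z0) ?implybT //.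
  by rewrite powR_inv1 // ltW.
pose W := (x * x^-1 `^ r^-1)%:C *: mpow Pe r^-1.
pose V := (y * y^-1 `^ r^-1)%:C *: mpow Qe r^-1.
have pW : pdmx W by exact: (pdZ (root x x0) (pd_pow _ pPe)).
have pV : pdmx V by exact: (pdZ (root y y0) (pd_pow _ pQe)).
have AW : lemx (Phi A) W by exact: pos_jensen_root.
have BV : lemx (Psi B) V by exact: pos_jensen_root.
have ZG := geomean_le_gm a01 (hPhi pA) (hPsi pB) pW pV AW BV.
have b1 := botprod_lemx kl pZ (gm_pd a pW pV) ZG.
have b2 := botprod_ando_hiai kl a01 r1 pW pV.
have eW : mpow W r = (x `^ (r - 1))%:C *: Pe.
  rewrite (mpow_scale _ (ltW (root x x0)) (pd_pow _ pPe).1) (rootr x x0).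
  by rewrite (mpowM _ _ (pd_herm pPe)) mulVf ?gt_eqF // (mpow1 pPe.1).
have eV : mpow V r = (y `^ (r - 1))%:C *: Qe.
  rewrite (mpow_scale _ (ltW (root y y0)) (pd_pow _ pQe).1) (rootr y y0).
  by rewrite (mpowM _ _ (pd_herm pQe)) mulVf ?gt_eqF // (mpow1 pQe.1).
set s := x `^ _ * y `^ _.
have s0 : 0 < s by rewrite mulr_gt0 // powR_gt0.
have eG : gm a (mpow W r) (mpow V r) = s%:C *: gm a Pe Qe.
  rewrite eW eV (gmZ a (powR_gt0 _ x0) (powR_gt0 _ y0) pPe pQe) -!powRrM.
  by rewrite /s [(r - 1) * (1 - a)]mulrC [(r - 1) * a]mulrC.
have [U [hU eX mon]] := lambda_spectral (psd_herm pX).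
have eXh : s%:C *: (X + h%:C%:M) = sp U (fun i => s * (lam X i + h)).
  by rewrite -spZ -spD -eX (sp_const _ hU).
have l0 i : 0 < s * (lam X i + h).
  by rewrite mulr_gt0 // ltr_wpDl // lam_ge0.
(* Uses [gm a Pe Qe <= X + h I]; the eigenvalues of the right side are read off in the eigenbasis of
   [X]. *)
have b3 : botprod k (lam (s%:C *: gm a Pe Qe)) <= botprod k (fun i => s * (lam X i + h)).
  rewrite -(@botprod_sp _ k l kl U (fun i => s * (lam X i + h)) hU
    (fun i => ltW (l0 i))); last first.
    by move=> i j ij; rewrite ler_pM2l // lerD2r mon.
  rewrite -eXh; apply: (botprod_lemx kl (psdZ (ltW s0) (gm_pd a pPe pQe).1)).
    by rewrite eXh; apply/(pd_sp _ hU).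
  exact: (lemxZ (ltW s0) he).
apply: (le_trans _ b3); rewrite -eG; apply: (le_trans _ b2).
apply: ge0_ler_powR b1; rewrite ?nnegrE; first exact: ltW.
  exact: (botprod_ge0 k pZ).
exact: (ltW (botprod_gt0 k (gm_pd a pW pV))).
Qed.

(** The norms are replaced by [x + h] and [y + h], positive even when a norm vanishes, with the same
    [h] that shifts the eigenvalues; one scalar limit removes all three. *)
Lemma botprod_le :
  botprod k (lam Z) `^ r <=
  \prod_(i < l | (l - k <= i)%N)
    (sgeomean a (opnorm (Phi 1%:M)) (opnorm (Psi 1%:M)) `^ (r - 1) * lam X i).
Proof.
have pI := hPhi (psd1 n); have pJ := hPsi (psd1 m).
set x := opnorm _; set y := opnorm _.
have x0 : 0 <= x := opnorm_ge0 pI.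
have y0 : 0 <= y := opnorm_ge0 pJ.
have hx : lemx (Phi 1%:M) x%:C%:M := psd_le_opnorm pI.
have hy : lemx (Psi 1%:M) y%:C%:M := psd_le_opnorm pJ.
clearbody x y.
have -> : sgeomean a x y `^ (r - 1) =
    x `^ ((1 - a) * (r - 1)) * y `^ (a * (r - 1)).
  by rewrite /sgeomean powRM ?powR_ge0 // -!powRrM.
have /andP[a0 a1] := a01.
have H : \prod_(i < l | (l - k <= i)%N)
    (((x + h) `^ ((1 - a) * (r - 1)) * (y + h) `^ (a * (r - 1))) * (lam X i + h))
    @[h --> (0 : R)^'+] -->
    \prod_(i < l | (l - k <= i)%N)
    ((x `^ ((1 - a) * (r - 1)) * y `^ (a * (r - 1))) * lam X i).
  apply: cvg_prod_fin => i; apply: cvgM.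
    by apply: cvgM; apply: powR_cvg_right => //; rewrite mulr_ge0 // subr_ge0.
  apply: cvg_at_right_filter; rewrite -[X in _ --> X]addr0.
  by apply: cvgD; [exact: cvg_cst|exact: cvg_id].
apply: (cvgr_to_ge H); near=> h.
have h0 : 0 < h by near: h; exact: nbhs_right_gt.
have hxh : x <= x + h by rewrite lerDl ltW.
have hyh : y <= y + h by rewrite lerDl ltW.
apply: botprod_le_regularized => //; rewrite ?ltr_wpDl //.
  exact: (lemx_trans hx (lemx_scalar l hxh)).
exact: (lemx_trans hy (lemx_scalar l hyh)).
Unshelve. all: by end_near. Qed.

End Supermajorization.
End PositiveMaps.

Theorem proposition4p2 (R : realType) (n m l : nat)
    (Phi : {linear 'M[R[i]]_n -> 'M[R[i]]_l})
    (Psi : {linear 'M[R[i]]_m -> 'M[R[i]]_l})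
    (hPhi : positive_map Phi) (hPsi : positive_map Psi)
    (alpha : R) (halpha : 0 <= alpha <= 1)
    (A : 'M[R[i]]_n) (B : 'M[R[i]]_m) (hA : psdmx A) (hB : psdmx B) :
  (forall r : R, 1 <= r ->
     wlog_supermaj
       ((sgeomean alpha (opnorm (Phi 1%:M)) (opnorm (Psi 1%:M))) `^ (r - 1)
        *: lambda (geomean alpha (Phi (mxpowR A r)) (Psi (mxpowR B r))))
       (rvpowR (lambda (geomean alpha (Phi A) (Psi B))) r))
  /\
  (sgeomean alpha (opnorm (Phi 1%:M)) (opnorm (Psi 1%:M)) <= 1 ->
   forall r : R, 1 <= r ->
     wlog_supermaj
       (lambda (geomean alpha (Phi (mxpowR A r)) (Psi (mxpowR B r))))
       (rvpowR (lambda (geomean alpha (Phi A) (Psi B))) r)).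
Proof.
set c := sgeomean _ _ _.
have c0 : 0 <= c by rewrite mulr_ge0 ?powR_ge0.
have psdP' (r : R) : psdmx (geomean alpha (Phi (mpow A r)) (Psi (mpow B r))).
  by case: (geomean_limit halpha (hPhi _ (mpow_psd r (psd_herm hA)))
    (hPsi _ (mpow_psd r (psd_herm hB)))).
have [psdZ' _ _] := geomean_limit halpha (hPhi _ hA) (hPsi _ hB).
have key (r : R) (k : nat) : 1 <= r -> (1 <= k <= l)%N ->
    \prod_(i < l | (l - k <= i)%N)
      rvpowR (lambda (geomean alpha (Phi A) (Psi B))) r 0 i <=
    \prod_(i < l | (l - k <= i)%N)
      (c `^ (r - 1) * lam (geomean alpha (Phi (mpow A r)) (Psi (mpow B r))) i).
  move=> r1 /andP[_ kl].
  apply: (le_trans _ (botprod_le hPhi hPsi halpha hA hB r1 kl)).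
  rewrite /botprod -prod_powR => [|i]; last exact: lam_ge0.
  by apply: ler_prod => i _; rewrite mxE lam.unlock powR_ge0 lexx.
have E n' (M : 'M[R[i]]_n') r : mxpowR M r = mpow M r by rewrite mpow.unlock.
clearbody c; split=> [r r1|c1 r r1]; rewrite !E => k hk.
  apply: (le_trans (key r k r1 hk)); rewrite le_eqVlt; apply/orP; left; apply/eqP.
  by apply: eq_bigr => i _; rewrite mxE lam.unlock.
(* When [c <= 1], also [c^(r-1) <= 1], and it multiplies nonnegative eigenvalues, so each factor can
   be compared separately. *)
apply: (le_trans (key r k r1 hk)); apply: ler_prod => i _.
have l0 := lam_ge0 i (psdP' r); rewrite mulr_ge0 ?powR_ge0 //=.
rewrite lam.unlock in l0 *; apply: ler_piMl => //.
by rewrite -[leRHS](one_powR (r - 1)); apply: ge0_ler_powR; rewrite ?nnegrE ?subr_ge0.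
Qed.
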